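(* Let $(m,f)$ be a unimodular $L_\infty$ algebra structure supported on a dg vector space $V$ of dimension $l|n$ (even dimension $l$, odd dimension $n$). (1) If $n>0$ or if $l$ is an odd number, then $(m,f)$ is equivalent to a strictly unimodular $L_\infty$ structure. (2) If $n=0$ and $l$ is an even number, then $(m,f)$ is equivalent to a unimodular $L_\infty$ structure of the form $(m',c\cdot x_1\cdots x_l)$, where $m'$ is a unimodular $L_\infty$ structure, $x_1,\dots,x_l$ is a basis in $\Pi V^*$ and $c\in\mathbf k$ is a number.
   Context: Conventions: the ground field $\mathbf k$ has characteristic zero; vector spaces are $\mathbb Z/2$-graded, $|x|$ is parity, $\Pi$ is parity reversion; all spaces $V,W$ here are finite-dimensional dg. $\hat SW^*$ is the completed symmetric algebra, $\hat S_{\ge n}W^*$ the ideal of series with all monomials of length $\ge n$, $\mathrm{Der}_{\ge n}(\hat SW^* )$ the continuous derivations mapping $W^*$ into $\hat S_{\ge n}W^*$. The differential of $W$ extends to an odd derivation $d$ of $\hat SW^*$ and acts on derivations by $d(\xi)=[d,\xi]$. For $\xi=\sum_if_i\partial_{x_i}$ ($x_i$ a homogeneous basis of $W^*$) the divergence is $\nabla\xi=\sum_i(-1)^{|f_i||x_i|}\partial_{x_i}f_i$. Let $\mathfrak g[W]=\mathrm{Der}_{\ge2}(\hat SW^* )\ltimes\Pi\hat S_{\ge1}W^*$ with bracket $[(\xi,\Pi f),(\eta,\Pi g)]=\big([\xi,\eta],\ \Pi\xi(g)-(-1)^{(|f|+1)|\eta|}\Pi\eta(f)\big)$ and differential $D(\xi,\Pi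 f)=\big([d,\xi],\ \Pi d(f)-\tfrac12(-1)^{|\xi|}\Pi\nabla\xi\big)$; this is a pronilpotent dgla. A unimodular $L_\infty$ structure on $V$ is a Maurer–Cartan element of $\mathfrak g[\Pi V]$; explicitly, a pair $(m,f)$ with $m\in\mathrm{Der}_{\ge2}(\hat S\Pi V^* )$ odd and $f\in\hat S_{\ge1}\Pi V^*$ even such that $d(m)+\frac12[m,m]=0$ and $d(f)+\frac12\nabla(m)+m(f)=0$. Two such structures are equivalent if they are gauge equivalent in $\mathfrak g[\Pi V]$, i.e. related by the action $e^y\cdot\zeta=\zeta+\sum_{n\ge1}\frac1{n!}(\mathrm{ad}\,y)^{n-1}([y,\zeta]-Dy)$ of an even $y\in\mathfrak g[\Pi V]$. A structure of the form $(m,0)$ is strictly unimodular (then $\nabla m=0$). By abuse of language the first component $m$ of a unimodular structure $(m,f)$ is itself also called a unimodular $L_\infty$ structure. *)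

(* Defs.v *)
(* boolp and functions provide the pointwise module structure on function
   types, used on series and on operators on series. *)
From mathcomp Require Import all_boot all_order all_algebra.
From mathcomp Require Import mpoly.
From mathcomp Require Import boolp functions.

Set Implicit Arguments.
Unset Strict Implicit.
Unset Printing Implicit Defensive.

Import GRing.Theory.
Local Open Scope ring_scope.

(* Parities are booleans, with [true] for odd. *)

Record dgVect (k : fieldType) := DgVect {
  dg_even : vectType k;
  dg_odd : vectType k;
  dg_d0 : 'Hom(dg_even, dg_odd);
  dg_d1 : 'Hom(dg_odd, dg_even);
  dg_d10 : forall v : dg_even, dg_d1 (dg_d0 v) = 0;
  dg_d01 : forall v : dg_odd, dg_d0 (dg_d1 v) = 0
}.

(* The completed symmetric algebra of W^*, where W^* has a basis of p even
   coordinates t_j and q odd coordinates s_i.  The pair (a, S) stands for the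
   monomial t^a * s_(i_1) * ... * s_(i_r) with S = {i_1 < ... < i_r}, and a
   series is the family of its coefficients. *)
Definition smono (p q : nat) : Type := ('X_{1..p} * {set 'I_q})%type.

Notation series k p q := (smono p q -> k^o).

Section Series.
Variables (k : fieldType) (p q : nat).
Implicit Types (f g : series k p q) (a : 'X_{1..p}) (S T U : {set 'I_q}).

Definition slen (m : smono p q) : nat := (mdeg m.1 + #|m.2|)%N.

Definition mono_series (m0 : smono p q) : series k p q :=
  fun m => (m == m0)%:R.

Definition sone : series k p q := mono_series (0%MM, set0).

(* For disjoint T and U, s_T * s_U = (-1) ^ (inversions T U) * s_(T :|: U). *)
Definition inversions T U : nat :=
  #|[set u : 'I_q * 'I_q | [&& u.1 \in T, u.2 \in U & (u.2 < u.1)%N]]|.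

(* Not the product [*] of function types, which is pointwise. *)
Definition smul f g : series k p q := fun m =>
  \sum_(b : 'X_{1..p < (mdeg m.1).+1} | (bmnm b <= m.1)%MM)
    \sum_(T : {set 'I_q} | T \subset m.2)
      (-1) ^+ inversions T (m.2 :\: T) *
        (f (bmnm b, T) * g ((m.1 - bmnm b)%MM, m.2 :\: T)).

Definition gen : Type := ('I_p + 'I_q)%type.

Definition gpar (i : gen) : bool := if i is inr _ then true else false.

Definition var (i : gen) : series k p q :=
  match i with
  | inl j => mono_series (U_(j)%MM, set0)
  | inr i => mono_series (0%MM, [set i])
  end.

(* Left partial derivatives. *)
Definition pderiv (i : gen) f : series k p q := fun m =>
  match i with
  | inl j => (m.1 j).+1%:R * f ((m.1 + U_(j))%MM, m.2)
  | inr i =>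
      if i \in m.2 then 0
      else (-1) ^+ #|[set t in m.2 | (t < i)%N]| * f (m.1, i |: m.2)
  end.

Definition shomog (par : bool) f : Prop :=
  forall m : smono p q, f m != 0 -> odd #|m.2| = par.

Definition sge (N : nat) f : Prop :=
  forall m : smono p q, (slen m < N)%N -> f m = 0.

Definition vfield (F : gen -> series k p q) (f : series k p q) : series k p q :=
  \sum_(i : gen) smul (F i) (pderiv i f).

(* Continuity is for the topology in which the ideals of series of length at
   least N form a basis of neighbourhoods of 0. *)
Definition is_der (par : bool) (xi : series k p q -> series k p q) : Prop :=
  [/\ forall (c : k) f g, xi (c *: f + g) = c *: xi f + xi g,
      forall (r : bool) f, shomog r f -> shomog (par (+) r) (xi f),
      forall (r : bool) f g, shomog r f ->
        xi (smul f g) =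
          smul (xi f) g + (-1) ^+ (par && r) *: smul f (xi g)
    & forall N, exists M, forall f, sge M f -> sge N (xi f)].

Definition is_der_ge (N : nat) (par : bool)
    (xi : series k p q -> series k p q) : Prop :=
  is_der par xi /\ forall i : gen, sge N (xi (var i)).

(* The divergence of a derivation of parity [par]: its i-th coefficient is
   xi x_i, of parity par + |x_i|. *)
Definition divergence (par : bool) (xi : series k p q -> series k p q) :
    series k p q :=
  \sum_(i : gen)
    (-1) ^+ ((par (+) gpar i) && gpar i) *: pderiv i (xi (var i)).

Definition der_bracket (r1 r2 : bool) (xi eta : series k p q -> series k p q) :
    series k p q -> series k p q :=
  fun f => xi (eta f) - (-1) ^+ (r1 && r2) *: eta (xi f).

End Series.

(* A pair (xi, f) stands for the element (xi, Pi f) of the dgla g[W]; it has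
   parity par when |xi| = par and |f| = par + 1. *)
Notation gla k p q := ((series k p q -> series k p q) * series k p q)%type.

Section Gla.
Variables (k : fieldType) (p q : nat).
(* The odd derivation of the completed symmetric algebra extending the
   differential of W. *)
Variable d : series k p q -> series k p q.
Implicit Types (y z w : gla k p q).

Definition in_gla (par : bool) z : Prop :=
  [/\ is_der_ge 2 par z.1, shomog (~~ par) z.2 & sge 1 z.2].

(* The bracket of elements z of parity r1 and w of parity r2. *)
Definition gbracket (r1 r2 : bool) z w : gla k p q :=
  (der_bracket r1 r2 z.1 w.1,
   z.1 w.2 - (-1) ^+ (r1 && r2) *: w.1 z.2).

Definition gdiff (par : bool) z : gla k p q :=
  (der_bracket true par d z.1,
   d z.2 - (2%:R^-1 * (-1) ^+ par) *: divergence par z.1).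

Definition maurer_cartan z : Prop :=
  in_gla true z /\
  gdiff true z + 2%:R^-1 *: gbracket true true z z = 0.

(* Membership in the N-th term of the filtration of g[W] by the ideals
   Der_(>= N+1) + Pi S_(>= N). *)
Definition gla_ge (N : nat) z : Prop :=
  (forall i : gen p q, sge N.+1 (z.1 (var k i))) /\ sge N z.2.

Definition gauge_term y z (i : nat) : gla k p q :=
  (i.+1`!)%:R^-1 *:
    iter i (gbracket false true y) (gbracket false true y z - gdiff false y).

(* w = e^y . z, the series converging for the filtration above. *)
Definition gauge_act y z w : Prop :=
  forall N, exists M0, forall M, (M0 <= M)%N ->
    gla_ge N (z + \sum_(i < M) gauge_term y z i - w).

Definition gauge_equiv z w : Prop :=
  exists y, in_gla false y /\ gauge_act y z w.

End Gla.

(* V has dimension l|n, with homogeneous basis (e0, e1), so Pi V^* has n even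
   coordinates t_j and l odd coordinates s_i, dual to Pi e1_j and Pi e0_i. *)
Section UnimodularLinf.
Variables (k : fieldType) (V : dgVect k) (l n : nat).
Variables (e0 : l.-tuple (dg_even V)) (e1 : n.-tuple (dg_odd V)).

(* Signs: d (Pi v) = - Pi (d v) on Pi V, and
   (d phi)(w) = - (-1)^|phi| phi (d w) on the dual of Pi V. *)
Definition dual_diff (i : gen n l) : series k n l :=
  match i with
  | inl j => \sum_(i < l) coord e1 j (dg_d0 V (tnth e0 i)) *: var k (inr i)
  | inr i => - \sum_(j < n) coord e0 i (dg_d1 V (tnth e1 j)) *: var k (inl j)
  end.

Definition diffW : series k n l -> series k n l := vfield dual_diff.

Definition unimodular_Linf (z : gla k n l) : Prop := maurer_cartan diffW z.

Definition strictly_unimodular_Linf (m : series k n l -> series k n l) : Prop :=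
  unimodular_Linf (m, 0).

Definition Linf_equiv (z w : gla k n l) : Prop := gauge_equiv diffW z w.

End UnimodularLinf.

(* s_1 * ... * s_l. *)
Definition odd_top (k : fieldType) (n l : nat) : series k n l :=
  \big[@smul k n l/@sone k n l]_(i < l) var k (inr i).

Arguments odd_top : clear implicits.

(* Main.v *)
Require Import Defs.
From mathcomp Require Import all_boot all_order all_algebra.
From mathcomp Require Import mpoly.
From mathcomp Require Import boolp functions.
From mathcomp Require Import zify ring.

Import GRing.Theory.
Local Open Scope ring_scope.

Set Implicit Arguments.
Unset Strict Implicit.
Unset Printing Implicit Defensive.

(** Write Q = d + m. The gauge transformation by an even element (xi, 0) sends
    (m, f) to (m', f') with
      d + m' = exp(ad xi) Q,
      f' = f + sum over n >= 1 of xi^(n-1) (xi f + div(xi) / 2) / n!,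
    so the theorem follows once xi is chosen such that f' has no coefficients
    except possibly at the product of all odd coordinates when there are no even
    ones.

    To first order in xi the series f' is f + div(xi) / 2, and almost every
    series is a divergence: if E is the sum of the t_j d/dt_j minus the sum of
    the s_i d/ds_i, then the divergence of g E, for g even, multiplies the
    coefficient of g at t^a s_S by n + |a| + l - |S| (divergence_lift_div). This
    number is positive except for n = 0, a = 0 and S = {1, ..., l}. The
    remaining terms of f' raise the length, so the condition on f' is a fixed
    point equation for a contraction in the length filtration
    (gauge_fun_lipschitz, exists_gauge_fun). The exceptional monomial has the
    parity of l, so an even f' has no such coefficient when l is odd.

    That (m', f') is again a Maurer-Cartan element (gauge_maurer_cartan) is
    proved termwise. With Q_n = ad(xi)^n (Q) / n! and f_n the n-th term of f',
    the convolutions E_n of the Q_a with the Q_b, and the sums C_n of all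
    Q_a f_b with a + b = n and of div(Q_n) / 2, satisfy
      (n + 1) E_(n+1) = [xi, E_n]  and  (n + 1) C_(n+1) = xi C_n,
    and both vanish for n = 0. The second recursion rests on the identity
    div [xi, Q] = xi (div Q) - Q (div xi) of divergence_bracket.

    Series are handled through two principles: a continuous linear operator is
    determined by its values on monomials (lincont_eq), and a continuous
    derivation by its values on generators (der_vfield). *)

(** * Bilinearity of the product *)

Section Algebra.
Variables (k : fieldType) (p q : nat).
Implicit Types (f g h : series k p q) (m : smono p q) (S T U : {set 'I_q}).
Local Notation mono := (@mono_series k p q).
Local Notation smul := (@smul k p q).
Local Notation x_ := (@var k p q).

Lemma addsE f g m : (f + g) m = f m + g m. Proof. by []. Qed.
Lemma scalesE (c : k) f m : (c *: f) m = c * f m. Proof. by []. Qed.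
Lemma oppsE f m : (- f) m = - f m. Proof. by []. Qed.

Let mul_left_commute3 (s a c b : k) : s * (a * (c * b)) = c * (s * (a * b)).
Proof. by rewrite (mulrCA a c) (mulrCA s c). Qed.

Lemma smulDl f g h : smul (f + g) h = smul f h + smul g h.
Proof.
apply/funext => m; rewrite [RHS]addsE /smul -big_split; apply: eq_bigr => b _ /=.
rewrite -big_split; apply: eq_bigr => T _ /=.
by rewrite mulrDl mulrDr.
Qed.

Lemma smulDr f g h : smul f (g + h) = smul f g + smul f h.
Proof.
apply/funext => m; rewrite [RHS]addsE /smul -big_split; apply: eq_bigr => b _ /=.
rewrite -big_split; apply: eq_bigr => T _ /=.
by rewrite 2!mulrDr.
Qed.

Lemma smulZl (c : k) f g : smul (c *: f) g = c *: smul f g.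
Proof.
apply/funext => m; rewrite [RHS]scalesE /smul mulr_sumr; apply: eq_bigr => b _ /=.
rewrite mulr_sumr; apply: eq_bigr => T _ /=.
by rewrite scalesE -mulrA; exact: (@mulrCA k).
Qed.

Lemma smulZr (c : k) f g : smul f (c *: g) = c *: smul f g.
Proof.
apply/funext => m; rewrite [RHS]scalesE /smul mulr_sumr; apply: eq_bigr => b _ /=.
rewrite mulr_sumr; apply: eq_bigr => T _ /=.
by rewrite scalesE; exact: mul_left_commute3.
Qed.

Lemma smul0l f : smul 0 f = 0.
Proof. by have := smulZl 0 0 f; rewrite !scale0r. Qed.

Lemma smul0r f : smul f 0 = 0.
Proof. by have := smulZr 0 f 0; rewrite !scale0r. Qed.

Lemma smulNl f g : smul (- f) g = - smul f g.
Proof. by rewrite -!scaleN1r smulZl. Qed.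

Lemma smulNr f g : smul f (- g) = - smul f g.
Proof. by rewrite -!scaleN1r smulZr. Qed.

Lemma smulBl f g h : smul (f - g) h = smul f h - smul g h.
Proof. by rewrite smulDl smulNl. Qed.

Lemma smulBr f g h : smul f (g - h) = smul f g - smul f h.
Proof. by rewrite smulDr smulNr. Qed.

Lemma smul_suml (I : Type) (r : seq I) (P : pred I) F g :
  smul (\sum_(i <- r | P i) F i) g = \sum_(i <- r | P i) smul (F i) g.
Proof. exact: (big_morph (smul^~ g) (fun a b => smulDl a b g) (smul0l g)). Qed.

Lemma smul_sumr (I : Type) (r : seq I) (P : pred I) F g :
  smul g (\sum_(i <- r | P i) F i) = \sum_(i <- r | P i) smul g (F i).
Proof. exact: (big_morph (smul g) (smulDr g) (smul0r g)). Qed.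

(** * Products with a monomial *)

(** Only one term of the convolution survives, which turns the double sum into
    a closed formula; all later computations with products go through it. *)
Lemma smul_monoE m0 g m :
  smul (mono m0) g m =
    if (m0.1 <= m.1)%MM && (m0.2 \subset m.2) then
      (-1) ^+ inversions m0.2 (m.2 :\: m0.2) *
        g ((m.1 - m0.1)%MM, m.2 :\: m0.2)
    else 0.
Proof.
case: m0 m => [a S] [b T] /=; rewrite /smul /=.
have zero b' S' : (b' == a) && (S' == S) = false ->
    mono (a, S) (b', S') = 0 by rewrite /mono_series xpair_eqE => ->.
case: ifPn => [/andP[le_ab sST] | nle].
  have lt_ab : (mdeg a < (mdeg b).+1)%N.
    by rewrite ltnS -(submK le_ab) mdegD leq_addl.
  rewrite (bigD1 (BMultinom lt_ab)) //= [X in _ + X]big1 ?addr0; last first.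
    move=> c /andP[_ nca]; rewrite big1 // => U _; rewrite zero ?mul0r ?mulr0 //.
    by rewrite bmeqP /= in nca; rewrite (negPf nca).
  rewrite (bigD1 S) //= [X in _ + X]big1 ?addr0; last first.
    move=> U /andP[_ nUS]; rewrite zero ?mul0r ?mulr0 //.
    by rewrite (negPf nUS) andbF.
  by rewrite /mono_series eqxx mul1r.
rewrite big1 // => c le_cb; rewrite big1 // => U sUT.
rewrite zero ?mul0r ?mulr0 //; apply/negbTE; apply: contra nle.
by case/andP=> /eqP <- /eqP <-; apply/andP.
Qed.

Lemma inversions0 U : inversions set0 U = 0%N.
Proof. by apply/eqP; rewrite cards_eq0; apply/eqP/setP=> u; rewrite !inE. Qed.

Lemma inversions0r U : inversions U set0 = 0%N.
Proof.
by apply/eqP; rewrite cards_eq0; apply/eqP/setP=> u; rewrite !inE /= andbF.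
Qed.

Lemma inversions1 i U : inversions [set i] U = #|[set t in U | (t < i)%N]|.
Proof.
rewrite /inversions -(card_imset _ (_ : injective (fun t : 'I_q => (i, t)))); last by move=> ? ? [].
apply: eq_card => -[u v]; rewrite !inE /=.
apply/idP/imsetP => [/andP[/eqP -> uv] | [t]]; first by exists v; rewrite ?inE.
by rewrite inE => tP [-> ->]; rewrite eqxx.
Qed.

Lemma inversionsUl S T U : [disjoint S & T] ->
  inversions (S :|: T) U = (inversions S U + inversions T U)%N.
Proof.
move=> dST; rewrite /inversions.
set A := [set u | _]; set B := [set u | _ & _]; set C := [set u | _ & _].
have -> : A = B :|: C.
  by apply/setP=> u; rewrite !inE; case: (_ \in S); case: (_ \in T);
     rewrite ?orbb ?orbF.
rewrite cardsU (_ : B :&: C = set0) ?cards0 ?subn0 //.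
apply/setP=> u; rewrite !inE.
by move: dST => /pred0P /(_ u.1) /=; case: (_ \in S); case: (_ \in T);
   rewrite ?andbF.
Qed.

Lemma inversionsUr S T U : [disjoint S & T] ->
  inversions U (S :|: T) = (inversions U S + inversions U T)%N.
Proof.
move=> dST; rewrite /inversions.
set A := [set u | _]; set B := [set u | _ & _]; set C := [set u | _ & _].
have -> : A = B :|: C.
  by apply/setP=> u; rewrite !inE; case: (_ \in S); case: (_ \in T); case: (_ \in U);
     rewrite ?orbb ?orbF ?andbF.
rewrite cardsU (_ : B :&: C = set0) ?cards0 ?subn0 //.
apply/setP=> u; rewrite !inE.
by move: dST => /pred0P /(_ u.2) /=; case: (_ \in S); case: (_ \in T);
   rewrite ?andbF.
Qed.

(** Each pair in S * T is an inversion for exactly one of the two orders. *)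
Lemma inversionsC S T : [disjoint S & T] ->
  (inversions S T + inversions T S)%N = (#|S| * #|T|)%N.
Proof.
move=> dST; rewrite /inversions -cardsX.
set A := [set u | _]; set B := [set u | _ & _].
rewrite -(card_imset B (_ : injective (fun u => (u.2, u.1)))); last first.
  by move=> [? ?] [? ?] [-> ->].
set B' := imset _ _.
have B'E u : u \in B' = [&& u.1 \in S, u.2 \in T & (u.1 < u.2)%N].
  apply/imsetP/idP => [[[v w]] | uP]; last first.
    by exists (u.2, u.1); [rewrite inE /= andbCA | case: u uP].
  by rewrite inE /= andbCA => ? ->.
rewrite -cardsUI (_ : A :&: B' = set0) ?cards0 ?addn0; last first.
  by apply/setP=> u; rewrite in_setI B'E !inE; do 2!case: (_ \in _) => //=; lia.
apply: eq_card => u; rewrite in_setU B'E !inE.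
have := pred0P dST u.1 => /=.
case: (u.1 \in S) => //=; case uT: (u.2 \in T) => //= ns.
by rewrite -neq_ltn; apply: contraFneq ns => /val_inj <-.
Qed.

Lemma smul1f f : smul (@sone k p q) f = f.
Proof.
apply/funext => -[a S]; rewrite smul_monoE /= sub0set inversions0 setD0 mul1r.
by rewrite andbT subm0 ifT //; apply/mnm_lepP => i; rewrite mnm0E.
Qed.

Lemma smul_var_even j f (m : smono p q) :
  smul (x_ (inl j)) f m = if (0 < m.1 j)%N then f ((m.1 - U_(j))%MM, m.2) else 0.
Proof.
rewrite /= smul_monoE /= sub0set inversions0 setD0 mul1r andbT.
congr (if _ then _ else _); apply/mnm_lepP/idP => [/(_ j)|jP i].
  by rewrite mnm1E eqxx.
by rewrite mnm1E; case: eqP => // <-.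
Qed.

Lemma smul_var_odd j f (m : smono p q) :
  smul (x_ (inr j)) f m =
    if j \in m.2 then (-1) ^+ #|[set t in m.2 | (t < j)%N]| * f (m.1, m.2 :\ j)
    else 0.
Proof.
rewrite /= smul_monoE /= sub1set subm0 inversions1.
rewrite (_ : (0 <= m.1)%MM = true) ?andTb; last first.
  by apply/mnm_lepP => i; rewrite mnm0E.
congr (if _ then (-1) ^+ _ * _ else _); apply: eq_card => t.
by rewrite !inE; case: eqVneq => //= ->; rewrite ltnn andbF.
Qed.

End Algebra.

(** * The length filtration *)

Section Continuity.
Variables (k : fieldType) (p q : nat).
Implicit Types (f g h : series k p q) (m : smono p q) (S T U : {set 'I_q}).
Local Notation mono := (@mono_series k p q).
Local Notation smul := (@smul k p q).
Local Notation x_ := (@var k p q).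

Lemma sge0 f : sge 0 f.
Proof. by []. Qed.

Lemma sge_zero N : sge N (0 : series k p q).
Proof. by []. Qed.

Lemma sgeW M N f : (M <= N)%N -> sge N f -> sge M f.
Proof. by move=> le_MN fN m lt_m; apply: fN; apply: leq_trans le_MN. Qed.

Lemma sgeD N f g : sge N f -> sge N g -> sge N (f + g).
Proof. by move=> fN gN m lt_m; rewrite addsE fN // gN // addr0. Qed.

Lemma sgeZ N (c : k) f : sge N f -> sge N (c *: f).
Proof. by move=> fN m lt_m; rewrite scalesE fN // mulr0. Qed.

Lemma sgeN N f : sge N f -> sge N (- f).
Proof. by move=> fN m lt_m; rewrite oppsE fN // oppr0. Qed.

Lemma sgeB N f g : sge N f -> sge N g -> sge N (f - g).
Proof. by move=> fN gN; apply: sgeD => //; apply: sgeN. Qed.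

Lemma sge_sum N (I : Type) (r : seq I) (P : pred I) (F : I -> series k p q) :
  (forall i, P i -> sge N (F i)) -> sge N (\sum_(i <- r | P i) F i).
Proof. by move=> FN; elim/big_ind: _ => // *; apply: sgeD. Qed.

Lemma eq_sge f g : (forall N, sge N (f - g)) -> f = g.
Proof.
move=> fg; apply/funext => m; apply/eqP; rewrite -subr_eq0; apply/eqP.
exact: fg (slen m).+1 m (leqnn _).
Qed.

Lemma sge_smul M N f g : sge M f -> sge N g -> sge (M + N) (smul f g).
Proof.
move=> fM gN m lt_m; rewrite /Defs.smul big1 // => b le_b; rewrite big1 // => T sT.
have lenE : (slen (bmnm b, T) + slen ((m.1 - b)%MM, m.2 :\: T) = slen m)%N.
  rewrite /slen /= addnACA -mdegD addmC submK //; congr (_ + _)%N.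
  by rewrite cardsD (setIidPr sT) subnKC // subset_leq_card.
have [lt_f | le_f] := ltnP (slen (bmnm b, T)) M; first by rewrite fM // mul0r mulr0.
rewrite gN ?mulr0 //; lia.
Qed.

Lemma sge_var i : sge 1 (x_ i).
Proof.
case: i => i /= m; rewrite ltnS leqn0 => /eqP m0; rewrite /mono_series.
  by case: eqP m0 => // -> /=; rewrite /slen /= mdeg1.
by case: eqP m0 => // -> /=; rewrite /slen /= cards1 addn1.
Qed.

(** * Continuous linear operators *)

Definition lincont (L : series k p q -> series k p q) : Prop :=
  (forall (c : k) f g, L (c *: f + g) = c *: L f + L g) /\
  (forall N, exists M, forall f, sge M f -> sge N (L f)).

Section Linear.
Variable L : series k p q -> series k p q.
Hypothesis linL : forall (c : k) f g, L (c *: f + g) = c *: L f + L g.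

Lemma lin0 : L 0 = 0.
Proof.
have := linL 1 0 0; rewrite !scale1r add0r => /esym/eqP.
by rewrite addrC -subr_eq0 addrK => /eqP.
Qed.

Lemma linD f g : L (f + g) = L f + L g.
Proof. by have := linL 1 f g; rewrite !scale1r. Qed.

Lemma linZ (c : k) f : L (c *: f) = c *: L f.
Proof. by have := linL c f 0; rewrite lin0 !addr0. Qed.

Lemma linN f : L (- f) = - L f.
Proof. by rewrite -!scaleN1r linZ. Qed.

Lemma linB f g : L (f - g) = L f - L g.
Proof. by rewrite linD linN. Qed.

Lemma lin_sum (I : Type) (r : seq I) (P : pred I) (F : I -> series k p q) :
  L (\sum_(i <- r | P i) F i) = \sum_(i <- r | P i) L (F i).
Proof. exact: (big_morph L linD lin0). Qed.
End Linear.

Lemma lincont_comp L L' : lincont L -> lincont L' -> lincont (fun f => L (L' f)).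
Proof.
move=> [linL cL] [linL' cL']; split=> [c f g|N]; first by rewrite linL' linL.
by have [M LM] := cL N; have [M' L'M] := cL' M; exists M' => f /L'M /LM.
Qed.

Lemma lincontZ (c : k) L : lincont L -> lincont (fun f => c *: L f).
Proof.
move=> [linL cL]; split=> [b f g|N].
  by rewrite linL scalerDr !scalerA mulrC.
by have [M LM] := cL N; exists M => f /LM; apply: sgeZ.
Qed.

Lemma lincontD L L' : lincont L -> lincont L' -> lincont (fun f => L f + L' f).
Proof.
move=> [linL cL] [linL' cL']; split=> [c f g|N].
  by rewrite linL linL' scalerDr addrACA.
have [M LM] := cL N; have [M' L'M] := cL' N; exists (maxn M M') => f fM.
by apply: sgeD; [apply: LM | apply: L'M]; apply: sgeW fM; rewrite ?leq_maxl ?leq_maxr.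
Qed.

Lemma lincont_sum (I : Type) (r : seq I) (F : I -> series k p q -> series k p q) :
  (forall i, lincont (F i)) -> lincont (fun f => \sum_(i <- r) F i f).
Proof.
move=> lF; elim: r => [|i r IH].
  under eq_fun do rewrite big_nil.
  by split=> [c f g|N]; [rewrite scaler0 addr0 | exists 0%N].
under eq_fun do rewrite big_cons.
exact: lincontD.
Qed.

Lemma lincont_smull g : lincont (smul g).
Proof.
split=> [c f h|N]; first by rewrite smulDr smulZr.
by exists N => f fN; apply: (sge_smul (sge0 g) fN).
Qed.

Lemma lincont_smulr g : lincont (smul^~ g).
Proof.
split=> [c f h|N]; first by rewrite smulDl smulZl.
by exists N => f fN; rewrite -[N]addn0; apply: (sge_smul fN (sge0 g)).
Qed.

(** Modulo series of length at least M, f is a finite combination of the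
    monomials that it involves. *)
Lemma lincont_eq L L' f : lincont L -> lincont L' ->
  (forall m, f m != 0 -> L (mono m) = L' (mono m)) -> L f = L' f.
Proof.
move=> [linL cL] [linL' cL'] LL'; apply: eq_sge => N.
have [M1 LM] := cL N; have [M2 L'M] := cL' N; pose M := maxn M1 M2.
(* The truncation of f below length M; the exponents b bound only the even
   degree, which keeps the index set finite and the remainder long. *)
pose t : series k p q :=
  \sum_(b : 'X_{1..p < M}) \sum_(S : {set 'I_q}) f (bmnm b, S) *: mono (bmnm b, S).
have tE m : (mdeg m.1 < M)%N -> t m = f m.
  case: m => [a S] /= lt_a; rewrite /t fct_sumE.
  rewrite (bigD1 (BMultinom lt_a)) //= fct_sumE (bigD1 S) //=.
  rewrite [X in _ + X + _]big1 ?[X in _ + X]big1 ?addr0.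
  - by rewrite scalesE /mono_series eqxx mulr1.
  - move=> b; rewrite bmeqP /= => nb; rewrite fct_sumE big1 // => T _.
    by rewrite scalesE /mono_series xpair_eqE eq_sym (negPf nb) mulr0.
  - move=> T nT.
    by rewrite scalesE /mono_series xpair_eqE [S == _]eq_sym (negPf nT) andbF mulr0.
have fM : sge M (f - t).
  move=> m lt_m; rewrite addsE oppsE tE ?subrr //.
  by apply: leq_ltn_trans lt_m; rewrite leq_addr.
have Lt : L t = L' t.
  rewrite /t (lin_sum linL) (lin_sum linL'); apply: eq_bigr => b _.
  rewrite (lin_sum linL) (lin_sum linL'); apply: eq_bigr => S _.
  rewrite (linZ linL) (linZ linL').
  by have [-> | /LL' ->] := eqVneq (f (bmnm b, S)) 0; rewrite ?scale0r.
have -> : L f - L' f = L (f - t) - L' (f - t).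
  by rewrite (linB linL) (linB linL') Lt opprB addrA subrK.
by apply: sgeB; [apply: LM | apply: L'M]; apply: sgeW fM; rewrite ?leq_maxl ?leq_maxr.
Qed.

(** * Associativity and graded commutativity *)

Lemma smul_mono m1 m2 :
  smul (mono m1) (mono m2) =
    if [disjoint m1.2 & m2.2] then
      (-1) ^+ inversions m1.2 m2.2 *: mono ((m1.1 + m2.1)%MM, m1.2 :|: m2.2)
    else 0.
Proof.
case: m1 m2 => [a S] [b T]; apply/funext => -[c U] /=; rewrite smul_monoE /=.
rewrite {1}/mono_series xpair_eqE.
have [dST | ndST] := boolP [disjoint S & T]; last first.
  case: ifP => // /andP[_ sSU]; case: (_ =P b) => /= _; last by rewrite mulr0.
  case: (_ =P T) => [ET|]; last by rewrite mulr0.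
  case/negP: ndST; rewrite -ET -setI_eq0; apply/eqP/setP => i; rewrite !inE.
  by case: (i \in S).
rewrite scalesE /mono_series xpair_eqE.
have [-> | nc] := eqVneq c (a + b)%MM; last first.
  rewrite andFb mulr0; case: ifP => // /andP[le_ac _].
  rewrite (_ : _ == b = false) ?mulr0 //; apply: contra_neqF nc => /eqP <-.
  by rewrite addmC submK.
rewrite lem_addr addmC addmK eqxx /=.
have [-> | nU] := eqVneq U (S :|: T).
  by rewrite subsetUl setDUl setDv set0U (setDidPl _) ?eqxx // disjoint_sym.
rewrite mulr0; case: ifP => // sSU; rewrite (_ : _ == T = false) ?mulr0 //.
apply: contra_neqF nU => /eqP <-; apply/setP=> i; rewrite !inE.
by have := subsetP sSU i; case: (i \in S) => //= ->.
Qed.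

(** Both sides are linear and continuous in f and g, so f and g may be taken to
    be monomials; the signs then agree because inversions are additive in each
    argument under disjoint unions. *)
Lemma smulA f g h : smul f (smul g h) = smul (smul f g) h.
Proof.
have L1 := lincont_comp (lincont_smulr h) (lincont_smulr g).
have R1 := lincont_smulr (smul g h).
apply: (lincont_eq R1 L1) => m1 _.
apply: (lincont_eq (lincont_comp (lincont_smull (mono m1)) (lincont_smulr h))
  (lincont_comp (lincont_smulr h) (lincont_smull (mono m1)))) => m2 _ {g L1 R1}.
case: m1 m2 => [a S] [b T]; apply/funext => -[c U].
rewrite smul_mono smul_monoE /= smul_monoE /= subsetD.
have [dST | ndST] := boolP [disjoint S & T]; last first.
  by rewrite smul0l disjoint_sym (negPf ndST) !andbF mulr0 if_same.
rewrite smulZl scalesE smul_monoE /= subUset disjoint_sym dST andbT.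
have -> : (a + b <= c)%MM = (a <= c)%MM && (b <= c - a)%MM.
  apply/idP/andP => [/mnm_lepP H | [/mnm_lepP Ha /mnm_lepP Hb]].
    by split; apply/mnm_lepP => i; have := H i; rewrite ?mnmBE mnmDE; lia.
  by apply/mnm_lepP => i; have := Ha i; have := Hb i; rewrite mnmBE mnmDE; lia.
case: (a <= c)%MM => /=; last by rewrite mulr0.
case: (S \subset U) / boolP => [sSU | _] /=; last by rewrite andbF mulr0.
case: (b <= c - a)%MM => /=; last by rewrite !mulr0.
case: (T \subset U) / boolP => [sTU | _]; last by rewrite !mulr0.
have -> : (c - (a + b) = c - a - b)%MM.
  by apply/mnmP => i; rewrite !mnmBE mnmDE subnDA.
have ES : U :\: S = T :|: (U :\: (S :|: T)).
  apply/setP=> i; rewrite !inE; have := subsetP sTU i.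
  by have := pred0P dST i => /=; case: (i \in S); case: (i \in T) => //= _ ->.
rewrite !mulrA -!exprD [X in inversions S X]ES inversionsUr; last first.
  by rewrite -setI_eq0; apply/eqP/setP => i; rewrite !inE; case: (i \in T); rewrite ?orbT.
by rewrite inversionsUl // setDDl addnA.
Qed.

Lemma smulf1 f : smul f (@sone k p q) = f.
Proof.
have idL : lincont id by split=> // N; exists N.
apply: (lincont_eq (lincont_smulr (@sone k p q)) idL) => -[a S] _.
rewrite smul_mono /= inversions0r scale1r setU0 addm0.
by rewrite disjoint_sym -setI_eq0 set0I eqxx.
Qed.

(** Reduced to monomials, this is the count of all pairs of odd generators by
    inversionsC. *)
Lemma smulC r s f g : shomog r f -> shomog s g ->
  smul f g = (-1) ^+ (r && s) *: smul g f.
Proof.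
move=> fr gs.
apply: (lincont_eq (lincont_smulr g) (lincontZ _ (lincont_smull g))) => m1 /fr r1.
apply: (lincont_eq (lincont_smull (mono m1)) (lincontZ _ (lincont_smulr (mono m1)))).
move=> m2 /gs s2; rewrite !smul_mono disjoint_sym.
case: ifP => [dST | _]; last by rewrite scaler0.
rewrite scalerA addmC setUC; congr (_ *: _).
rewrite -r1 -s2 -oddM signr_odd -inversionsC 1?disjoint_sym // exprD -mulrA -expr2 sqrr_sign.
by rewrite mulr1.
Qed.

(** * Monomials as products of generators *)

(** Closure under scalars absorbs the sign that appears when an odd generator
    is pulled out of the middle of a monomial. *)
Lemma mono_ind (P : series k p q -> Prop) :
  P (@sone k p q) -> (forall (c : k) f, P f -> P (c *: f)) ->
  (forall i f, P f -> P (smul (x_ i) f)) -> forall m, P (mono m).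
Proof.
move=> P1 PZ Px m; have [N] := ubnP (slen m).
elim: N m => // N IH [a S]; rewrite ltnS => lenN.
have [a0 | na0] := eqVneq a 0%MM; last first.
  have [j ja] : exists j, (0 < a j)%N.
    apply/existsP; apply: contraR na0 => /existsPn a0.
    by apply/eqP/mnmP => j; rewrite mnm0E; have := a0 j; rewrite -eqn0Ngt => /eqP.
  have aE : (U_(j) + (a - U_(j)) = a)%MM.
    rewrite addmC submK //; apply/mnm_lepP => i; rewrite mnm1E.
    by case: eqP => // <-.
  have -> : mono (a, S) = smul (x_ (inl j)) (mono ((a - U_(j))%MM, S)).
    rewrite smul_mono /= inversions0 scale1r set0U aE ifT //.
    by rewrite -setI_eq0 set0I.
  apply: Px; apply: IH; apply: leq_trans lenN.
  by rewrite /slen /= ltn_add2r -[X in (_ < mdeg X)%N]aE mdegD mdeg1.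
rewrite a0 {a0} in lenN *.
have [-> // | [i iS]] := set_0Vmem S.
have SE : i |: S :\ i = S by rewrite setD1K.
have Pi : P (smul (x_ (inr i)) (mono (0%MM, S :\ i))).
  apply: Px; apply: IH; apply: leq_trans lenN.
  by rewrite /slen /= (cardsD1 i S) iS mdeg0.
move: Pi; rewrite smul_mono /= addm0 SE ifT; last first.
  by rewrite disjoints1 !inE eqxx.
by move/(PZ ((-1) ^+ inversions [set i] (S :\ i))); rewrite scalerA -exprD addnn -mul2n exprM sqrrN expr1n expr1n scale1r.
Qed.

(** * Parity *)

Lemma shomog0 r : shomog r (0 : series k p q).
Proof. by move=> m; rewrite eqxx. Qed.

Lemma shomogD r f g : shomog r f -> shomog r g -> shomog r (f + g).
Proof.
move=> fr gr m; rewrite addsE; have [f0 | /fr //] := eqVneq (f m) 0.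
by rewrite f0 add0r => /gr.
Qed.

Lemma shomogZ r (c : k) f : shomog r f -> shomog r (c *: f).
Proof.
by move=> fr m nz; apply: fr; apply: contraNneq nz => f0; rewrite scalesE f0 mulr0.
Qed.

Lemma shomog_sum r (I : Type) (s : seq I) (P : pred I) (F : I -> series k p q) :
  (forall i, P i -> shomog r (F i)) -> shomog r (\sum_(i <- s | P i) F i).
Proof.
by move=> FN; elim/big_ind: _ => //; [apply: shomog0 | move=> *; apply: shomogD].
Qed.

Lemma shomog_smul r s f g :
  shomog r f -> shomog s g -> shomog (r (+) s) (smul f g).
Proof.
move=> fr gs m; apply: contra_neqP => nm; rewrite /Defs.smul big1 // => b _.
rewrite big1 // => T sT.
have [f0 | /fr fr'] := eqVneq (f (bmnm b, T)) 0; first by rewrite f0 mul0r mulr0.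
have [g0 | /gs gs'] := eqVneq (g ((m.1 - b)%MM, m.2 :\: T)) 0.
  by rewrite g0 !mulr0.
case: nm; rewrite -fr' -gs' /= -oddD cardsD (setIidPr sT).
by rewrite subnKC // subset_leq_card.
Qed.

Lemma shomog_var i : shomog (gpar i) (x_ i).
Proof.
by case: i => i m /=; rewrite /mono_series; case: (m =P _) => [-> _|_];
   rewrite /= ?cards0 ?cards1 ?eqxx.
Qed.

Lemma shomog_eq_sge r f :
  (forall N, exists2 g, shomog r g & sge N (f - g)) -> shomog r f.
Proof.
move=> H m; have [g gr fg] := H (slen m).+1.
have /eqP := fg m (leqnn _); rewrite addsE oppsE subr_eq0 => /eqP ->.
exact: gr.
Qed.

End Continuity.

Section Derivations.
Variables (k : fieldType) (p q : nat).
Implicit Types (f g h : series k p q) (m : smono p q) (S T U : {set 'I_q}).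
Implicit Types (L xi eta : series k p q -> series k p q) (F : gen p q -> series k p q).
Local Notation mono := (@mono_series k p q).
Local Notation smul := (@smul k p q).
Local Notation x_ := (@var k p q).
Local Notation one := (@sone k p q).
Local Notation pderiv := (@pderiv k p q).

Lemma sign_andb_addr (a b c : bool) :
  (-1) ^+ (a && (b (+) c)) = (-1) ^+ (a && b) * (-1) ^+ (a && c) :> k.
Proof. by rewrite andb_addr signr_addb. Qed.

(** * Partial derivatives *)

Lemma pderiv_linear i (c : k) f g :
  pderiv i (c *: f + g) = c *: pderiv i f + pderiv i g.
Proof.
apply/funext => m; rewrite addsE scalesE; case: i => i /=.
  by rewrite addsE scalesE mulrDr; congr (_ + _); apply: (@mulrCA k).
case: ifP => _; first by rewrite mulr0 addr0.
by rewrite addsE scalesE mulrDr; congr (_ + _); apply: (@mulrCA k).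
Qed.

Lemma sge_pderiv i N f : sge N f -> sge N.-1 (pderiv i f).
Proof.
move=> fN [a S] lt_m; case: i => i /=; first by rewrite fN ?mulr0 //;
  move: lt_m; rewrite /slen /= mdegD mdeg1 addn1 addSn; case: (N).
case: ifPn => // iS; rewrite fN ?mulr0 //.
by move: lt_m; rewrite /slen /= cardsU1 iS add1n addnS; case: (N).
Qed.

Lemma lincont_pderiv i : lincont (pderiv i).
Proof.
split=> [|N]; first exact: pderiv_linear.
by exists N.+1 => f; apply: sge_pderiv.
Qed.

Lemma shomog_pderiv r i f : shomog r f -> shomog (gpar i (+) r) (pderiv i f).
Proof.
move=> fr [a S]; case: i => i /=.
  by move=> nz; apply: (fr ((a + U_(i))%MM, S)); apply: contraNneq nz => ->; rewrite mulr0.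
case: ifPn => [_ | iS nz]; first by rewrite eqxx.
have <- : odd #|i |: S| = r.
  by apply: (fr (a, _)); apply: contraNneq nz => ->; rewrite mulr0.
by rewrite cardsU1 iS /= negbK.
Qed.

Lemma pderiv_one i : pderiv i one = 0.
Proof.
apply/funext => -[a S]; case: i => i /=; rewrite /sone /mono_series xpair_eqE.
  by rewrite mnmD_eq0 mnm1_eq0 andbF mulr0.
case: ifP => // _; rewrite (_ : i |: S == set0 = false) ?andbF ?mulr0 //.
by apply/negbTE/set0Pn; exists i; rewrite !inE eqxx.
Qed.

(** For two distinct odd generators, the signs on the two sides differ exactly
    by the contribution of the pair (i, j) itself, since one of i < j and j < i
    holds. *)
Lemma pderiv_smul_var i j f :
  pderiv i (smul (x_ j) f) =
    (i == j)%:R *: f + (-1) ^+ (gpar i && gpar j) *: smul (x_ j) (pderiv i f).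
Proof.
apply/funext => -[a S]; rewrite addsE !scalesE.
case: i j => [i|i] [j|j].
- rewrite [pderiv _ _ _]/= !smul_var_even /= mul1r mnmDE mnm1E.
  rewrite (inj_eq (fun x y (e : inl x = inl y) => let: erefl := e in erefl)).
  have [<- | nij] := eqVneq i j.
    rewrite addn1 ltn0Sn addmK mul1r; case: ifP => a0.
      rewrite mnmBE mnm1E eqxx subn1 prednK // addmC.
      rewrite (_ : _ + (_ - _) = a)%MM; first by rewrite -natr1 mulrDl mul1r addrC.
      rewrite addmC submK //; apply/mnm_lepP => t; rewrite mnm1E.
      by case: eqP => // <-.
    by rewrite addr0 (_ : a i = 0%N) ?mul1r //; move: a0; lia.
  rewrite addn0 mul0r add0r; case: ifP => a0; last by rewrite mulr0.
  rewrite mnmBE mnm1E eq_sym (negPf nij) subn0; congr (_ * f (_, _)).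
  apply/mnmP => t; rewrite !(mnmBE, mnmDE) !mnm1E.
  by case: (eqVneq j t) => [<-|_] /=; rewrite ?(negPf nij); move: a0; lia.
- rewrite [pderiv _ _ _]/= !smul_var_odd /= mul0r add0r mul1r.
  by case: ifP => _; rewrite ?mulr0 //; apply: (@mulrCA k).
- rewrite [pderiv _ _ _]/= !smul_var_even /= mul0r add0r mul1r.
  by do 2!case: ifP => _ //; rewrite ?mulr0.
rewrite [pderiv _ _ _]/= !smul_var_odd /= expr1 mulN1r.
rewrite (inj_eq (fun x y (e : inr x = inr y) => let: erefl := e in erefl)).
rewrite !inE; have [<- | nij] := eqVneq i j; rewrite /= ?mul1r ?mul0r.
  have below T : (forall t, t != i -> (t \in T) = (t \in S)) ->
      #|[set t in T | (t < i)%N]| = #|[set t in S | (t < i)%N]|.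
    move=> TS; apply: eq_card => t; rewrite !inE.
    by case: (eqVneq t i) => [->|/TS ->//]; rewrite ltnn !andbF.
  have below1 T (c : k) : (forall t, t != i -> (t \in T) = (t \in S)) ->
      (-1) ^+ #|[set t in S | (t < i)%N]| *
        ((-1) ^+ #|[set t in T | (t < i)%N]| * c) = c.
    by move=> /below ->; rewrite mulrA -expr2 sqrr_sign mul1r.
  case: ifPn => iS.
    rewrite setD1K // below1; first exact/esym/(@subrr k).
    by move=> t nti; rewrite !inE nti.
  rewrite setU1K // below1; first by rewrite oppr0 addr0.
  by move=> t nti; rewrite !inE (negPf nti).
rewrite add0r; case: (boolP (i \in S)) => iS /=.
  by rewrite mulr0 if_same oppr0.
case: ifP => jS; last by rewrite mulr0 oppr0.
have -> : (i |: S) :\ j = i |: S :\ j.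
  apply/setP=> t; rewrite !inE; case: (eqVneq t i) => [->|] //=.
  by rewrite nij.
rewrite !mulrA -!exprD -mulNr; congr (_ * _); rewrite -[RHS]mulN1r -exprS.
rewrite -signr_odd -[RHS]signr_odd; congr ((-1) ^+ nat_of_bool _).
have -> : #|[set t in i |: S | (t < j)%N]| = ((i < j) + #|[set t in S | (t < j)%N]|)%N.
  rewrite (cardsD1 i) !inE eqxx /=; congr (_ + _)%N; apply: eq_card => t.
  by rewrite !inE; case: (eqVneq t i) => [->|] //=; rewrite (negPf iS).
have -> : #|[set t in S | (t < i)%N]| = ((j < i) + #|[set t in S :\ j | (t < i)%N]|)%N.
  rewrite (cardsD1 j) !inE jS /=; congr (_ + _)%N; apply: eq_card => t.
  by rewrite !inE andbA.
have nlt : (j < i)%N = ~~ (i < j)%N.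
  rewrite ltnNge leq_eqVlt negb_or; case: (i < j)%N => //=; rewrite ?andbF ?andbT //.
rewrite oddS !oddD nlt !oddb.
by case: (i < j)%N; do 2!case: (odd _).
Qed.

Lemma pderiv_var i j : pderiv i (x_ j) = (i == j)%:R *: one.
Proof. by rewrite -[x_ j]smulf1 pderiv_smul_var pderiv_one smul0r scaler0 addr0. Qed.

(** * Derivations and their values on generators *)

Lemma shomog_one : shomog false one.
Proof.
by move=> m; rewrite /sone /mono_series; case: (m =P _) => [-> _|_];
   rewrite ?cards0 ?eqxx.
Qed.

(** By induction on monomials, the Leibniz rule only has to be checked when
    the first factor is a generator. *)
Lemma is_der_of_vars par L : lincont L ->
  (forall r f, shomog r f -> shomog (par (+) r) (L f)) -> L one = 0 ->
  (forall j f, L (smul (x_ j) f) =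
     smul (L (x_ j)) f + (-1) ^+ (par && gpar j) *: smul (x_ j) (L f)) ->
  is_der par L.
Proof.
move=> [linL cL] Lpar L1 Lvar; split=> // r f g fr.
have lL : lincont L by [].
apply: (lincont_eq (lincont_comp lL (lincont_smulr g))
  (lincontD (lincont_comp (lincont_smulr g) lL) (lincontZ _ (lincont_smulr (L g))))).
move=> m /fr m_r.
pose P f := exists2 s, shomog s f & L (smul f g) =
  smul (L f) g + (-1) ^+ (par && s) *: smul f (L g).
suff [s ms -> ] : P (mono m).
  by have := ms m; rewrite /mono_series eqxx oner_eq0 => /(_ isT) <-; rewrite m_r.
clear m_r; apply: (mono_ind (P := P)) => [|c h [s hs Lh]|i h [s hs Lh]].
- exists false; last by rewrite andbF scale1r L1 smul0l add0r !smul1f.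
  exact: shomog_one.
- exists s; first exact: shomogZ.
  by rewrite !smulZl !(linZ linL) Lh smulZl scalerDr !scalerA mulrC.
exists (gpar i (+) s); first exact/shomog_smul/hs/shomog_var.
rewrite -smulA !Lvar Lh smulDl smulZl !smulDr !scalerDr -!smulA addrA.
by rewrite sign_andb_addr smulZr scalerA.
Qed.

Lemma is_der_lincont par xi : is_der par xi -> lincont xi.
Proof. by case. Qed.

Lemma is_der_pderiv i : is_der (gpar i) (pderiv i).
Proof.
apply: is_der_of_vars; first exact: lincont_pderiv.
- by move=> r f; apply: shomog_pderiv.
- exact: pderiv_one.
by move=> j f; rewrite pderiv_smul_var pderiv_var smulZl smul1f.
Qed.

Lemma lincont_vfield F : lincont (vfield F).
Proof.
have -> : vfield F = fun f => \sum_i smul (F i) (pderiv i f) by [].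
apply: lincont_sum => i.
exact: (lincont_comp (lincont_smull (F i)) (lincont_pderiv i)).
Qed.

Lemma vfield_var F j : vfield F (x_ j) = F j.
Proof.
rewrite /vfield (bigD1 j) //= big1 ?addr0 => [|i nij]; rewrite pderiv_var.
  by rewrite eqxx scale1r smulf1.
by rewrite (negPf nij) scale0r smul0r.
Qed.

(** The sign picked up when x_j moves past the coefficient F i combines with the
    one from the partial derivative to a sign that does not depend on i. *)
Lemma vfield_smul_var par F j f :
  (forall i, shomog (par (+) gpar i) (F i)) ->
  vfield F (smul (x_ j) f) =
    smul (F j) f + (-1) ^+ (par && gpar j) *: smul (x_ j) (vfield F f).
Proof.
move=> Fpar; rewrite /vfield.
under eq_bigr do rewrite pderiv_smul_var smulDr !smulZr.
rewrite big_split /=; congr (_ + _).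
  rewrite (bigD1 j) //= big1 ?addr0 => [|i /negPf ->]; last by rewrite scale0r.
  by rewrite eqxx scale1r.
rewrite smul_sumr scaler_sumr; apply: eq_bigr => i _.
rewrite !smulA (smulC (Fpar i) (@shomog_var k p q j)) smulZl scalerA; congr (_ *: _).
by rewrite -signr_addb; case: par {Fpar}; case: (gpar i); case: (gpar j).
Qed.

Lemma is_der_vfield par F :
  (forall i, shomog (par (+) gpar i) (F i)) -> is_der par (vfield F).
Proof.
move=> Fpar; apply: is_der_of_vars; first exact: lincont_vfield.
- move=> r f fr; apply: shomog_sum => i _.
  have := shomog_smul (Fpar i) (shomog_pderiv (i := i) fr).
  by rewrite addbA -[par (+) _ (+) _]addbA addbb addbF.
- by rewrite /vfield big1 // => i _; rewrite pderiv_one smul0r.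
by move=> j f; rewrite (vfield_smul_var _ _ Fpar) vfield_var.
Qed.

Lemma der_one par xi : is_der par xi -> xi one = 0.
Proof.
move=> [_ _ /(_ false one one shomog_one) + _]; rewrite andbF scale1r !smul1f smulf1.
by move=> /esym/eqP; rewrite -subr_eq0 addrK => /eqP.
Qed.

Lemma der_smul_var par xi j f : is_der par xi ->
  xi (smul (x_ j) f) =
    smul (xi (x_ j)) f + (-1) ^+ (par && gpar j) *: smul (x_ j) (xi f).
Proof. by move=> [_ _ leib _]; apply: leib; apply: shomog_var. Qed.

Lemma der_var_shomog par xi i : is_der par xi -> shomog (par (+) gpar i) (xi (x_ i)).
Proof. by move=> [_ xipar _ _]; apply/xipar/shomog_var. Qed.

(** Both sides are continuous, vanish on 1 and obey the same rule for
    multiplication by a generator. *)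
Lemma der_vfield par xi f : is_der par xi -> xi f = vfield (fun i => xi (x_ i)) f.
Proof.
move=> dxi; apply: (lincont_eq (is_der_lincont dxi) (lincont_vfield _)) => m _.
have [linv _] := lincont_vfield (fun i => xi (x_ i)).
have [linxi _ _ _] := dxi.
apply: (mono_ind (P := fun h => xi h = vfield (fun i => xi (x_ i)) h)) => [|c h IH|i h IH].
- by rewrite (der_one dxi) /vfield big1 // => i _; rewrite pderiv_one smul0r.
- by rewrite (linZ linxi) (linZ linv) IH.
rewrite (der_smul_var _ _ dxi) IH (vfield_smul_var (par := par)) // => j.
exact: der_var_shomog.
Qed.

Lemma der_ext par xi eta : is_der par xi -> is_der par eta ->
  (forall i, xi (x_ i) = eta (x_ i)) -> forall f, xi f = eta f.
Proof.
move=> dxi deta xe f; rewrite (der_vfield f dxi) (der_vfield f deta).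
by apply: eq_bigr => i _; rewrite xe.
Qed.

Lemma is_der_bracket r1 r2 xi eta : is_der r1 xi -> is_der r2 eta ->
  is_der (r1 (+) r2) (der_bracket r1 r2 xi eta).
Proof.
move=> dxi deta; have [linxi parxi leibxi _] := dxi; have [lineta pareta leibeta _] := deta.
have lcb : lincont (der_bracket r1 r2 xi eta).
  have l1 := lincont_comp (is_der_lincont dxi) (is_der_lincont deta).
  have l2 := lincont_comp (is_der_lincont deta) (is_der_lincont dxi).
  have := lincontD l1 (lincontZ (- (-1) ^+ (r1 && r2)) l2).
  by rewrite /der_bracket; under eq_fun do rewrite scaleNr.
split; [by case: lcb | | | by case: lcb].
- move=> r f fr; rewrite /der_bracket -scaleNr; apply: shomogD.
    by rewrite -addbA; apply/parxi/pareta.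
  by apply: shomogZ; rewrite [r1 (+) _]addbC -addbA; apply/pareta/parxi.
move=> r f g fr; rewrite /der_bracket.
rewrite (leibeta _ _ _ fr) (leibxi _ _ _ fr) !(linD linxi) !(linD lineta).
rewrite !(linZ linxi) !(linZ lineta).
rewrite !(leibxi _ _ _ fr) !(leibeta _ _ _ fr).
rewrite (leibxi _ _ _ (pareta _ _ fr)) (leibeta _ _ _ (parxi _ _ fr)).
rewrite smulBl smulBr smulZl smulZr !(scalerDr, scalerN) !scalerA.
rewrite -!signr_addb !andb_addr.
case: r1 r2 r {dxi deta linxi parxi leibxi lineta pareta leibeta lcb fr} => [] [] [];
  rewrite /= ?expr0 ?expr1 ?scale1r ?scaleN1r ?opprD ?opprK;
  move: (smul (xi (eta f)) g) (smul (eta f) (xi g)) (smul (xi f) (eta g))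
        (smul f (xi (eta g))) (smul (eta (xi f)) g) (smul f (eta (xi g))) => A B C D E G.
all: apply/funext => m; rewrite ?(addsE, oppsE).
all: by ring.
Qed.

(** * Operators raising the length *)

(** Shifts in the length filtration control the convergence of exponentials:
    if xi raises the length by 1, then its n-fold bracket raises it by n. *)
Definition raises N L : Prop := forall M f, sge M f -> sge (M + N) (L f).

Lemma raisesW N N' L : (N <= N')%N -> raises N' L -> raises N L.
Proof. by move=> le L' M f /L'; apply: sgeW; rewrite leq_add2l. Qed.

Lemma raises_sge N L f : raises N L -> sge N (L f).
Proof. by move=> rL; have := rL 0%N f (sge0 f). Qed.

Lemma raises_vfield N F : (forall i, sge N.+1 (F i)) -> raises N (vfield F).
Proof.
move=> FN M f fM; apply: sge_sum => i _.
have := sge_smul (FN i) (sge_pderiv i fM); apply: sgeW; lia.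
Qed.

Lemma raises_der N par xi :
  is_der par xi -> (forall i, sge N.+1 (xi (x_ i))) -> raises N xi.
Proof.
by move=> dxi xiN M f fM; rewrite (der_vfield f dxi); apply: raises_vfield.
Qed.

Lemma raises_der_ge N par xi : is_der_ge N.+1 par xi -> raises N xi.
Proof. by case=> dxi; apply: raises_der dxi. Qed.

Lemma raises_var N L i : raises N L -> sge N.+1 (L (x_ i)).
Proof. by move=> rL; rewrite -add1n; apply/rL/sge_var. Qed.

End Derivations.

Section Divergence.
Variables (k : fieldType) (p q : nat).
Implicit Types (f g h : series k p q) (m : smono p q).
Implicit Types (D Q xi eta : series k p q -> series k p q).
Local Notation smul := (@smul k p q).
Local Notation x_ := (@var k p q).
Local Notation pderiv := (@pderiv k p q).

(** * Divergence *)

Lemma divergence_odd Q : divergence true Q = \sum_i pderiv i (Q (x_ i)).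
Proof. by apply: eq_bigr => -[] i _; rewrite /= scale1r. Qed.

Lemma divergence_even xi :
  divergence false xi = \sum_i (-1) ^+ gpar i *: pderiv i (xi (x_ i)).
Proof. by apply: eq_bigr => -[] i _. Qed.

Lemma sge_divergence N par D :
  (forall i, sge N.+1 (D (x_ i))) -> sge N (divergence par D).
Proof.
by move=> DN; apply: sge_sum => i _; apply: sgeZ; apply: (sge_pderiv i (DN i)).
Qed.

(** The commutator of a partial derivative with a derivation D is again a
    derivation, and its values on generators are those of the coefficients
    of D. *)
Lemma pderiv_der par D i f : is_der par D ->
  pderiv i (D f) = (-1) ^+ (gpar i && par) *: D (pderiv i f)
    + \sum_j smul (pderiv i (D (x_ j))) (pderiv j f).
Proof.
move=> dD; have linD : forall (c : k) f g, D (c *: f + g) = c *: D f + D g by case: dD.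
have := der_vfield f (is_der_bracket (@is_der_pderiv k p q i) dD).
rewrite {1}/der_bracket => /eqP; rewrite subr_eq addrC => /eqP ->.
congr (_ + _); apply: eq_bigr => j _; congr (smul _ _).
by rewrite /der_bracket pderiv_var (linZ linD) (der_one dD) !scaler0 subr0.
Qed.

(** The terms with second derivatives of the coefficients give the right-hand
    side; the products of first derivatives cancel in pairs, because the
    factors of each product commute. *)
Lemma divergence_bracket xi Q : is_der false xi -> is_der true Q ->
  divergence true (der_bracket false true xi Q) =
    xi (divergence true Q) - Q (divergence false xi).
Proof.
move=> dxi dQ.
have linxi : forall (c : k) f g, xi (c *: f + g) = c *: xi f + xi g by case: dxi.
have linQ : forall (c : k) f g, Q (c *: f + g) = c *: Q f + Q g by case: dQ.
have linp i := @pderiv_linear k p q i.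
rewrite !divergence_odd divergence_even (lin_sum linxi) (lin_sum linQ) -sumrB.
rewrite /der_bracket; under eq_bigr => i _.
  rewrite scale1r (linB (linp i)) (pderiv_der i (Q (x_ i)) dxi).
  rewrite (pderiv_der i (xi (x_ i)) dQ).
  rewrite andbF andbT scale1r -(linZ linQ) opprD addrACA.
  over.
rewrite big_split /= [X in _ + X](_ : _ = 0) ?addr0 // sumrB.
rewrite [X in _ - X]exchange_big /= -sumrB big1 // => i _; rewrite -sumrB.
rewrite big1 // => j _; apply/eqP; rewrite subr_eq0; apply/eqP.
have hxi := shomog_pderiv (i := i) (der_var_shomog (i := j) dxi).
have hQ := shomog_pderiv (i := j) (der_var_shomog (i := i) dQ).
rewrite (smulC hxi hQ) (_ : _ && _ = false) ?scale1r //.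
by case: (gpar i); case: (gpar j).
Qed.

End Divergence.

Section Summation.
Variables (k : fieldType) (p q : nat).
Implicit Types (f g h : series k p q) (m : smono p q) (u : nat -> series k p q).
Implicit Types (D : series k p q -> series k p q).
Implicit Types (L : nat -> series k p q -> series k p q).
Local Notation smul := (@smul k p q).
Local Notation x_ := (@var k p q).

(** * Summation of sequences of increasing length *)

(** The sum of all u n when u n only has monomials of length at least n: the
    omitted terms then do not contribute to the coefficient of m. *)
Definition ssum u : series k p q := fun m => \sum_(n < (slen m).+1) u n m.

Lemma ssum_sge u M : (forall n, sge n (u n)) -> sge M (ssum u - \sum_(n < M) u n).
Proof.
move=> un m lt_m; rewrite addsE oppsE /ssum fct_sumE.
rewrite (big_ord_widen _ (fun n => u n m) lt_m) big_mkcond /= -sumrB big1 // => n _.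
by case: ltnP => [_ | lt_n]; rewrite ?subrr // un // subr0.
Qed.

Lemma ssum_sge_all N u : (forall n, sge N (u n)) -> sge N (ssum u).
Proof. by move=> uN m lt_m; rewrite /ssum big1 // => n _; rewrite uN. Qed.

Lemma ssum_eq u f : (forall n, sge n (u n)) ->
  (forall M, sge M (f - \sum_(n < M) u n)) -> f = ssum u.
Proof.
move=> un fu; apply: eq_sge => M.
have -> : f - ssum u = (f - \sum_(n < M) u n) - (ssum u - \sum_(n < M) u n).
  by rewrite opprB addrA subrK.
by apply: sgeB; [apply: fu | apply: ssum_sge].
Qed.

Lemma ssum0 u : (forall n, u n = 0) -> ssum u = 0.
Proof. by move=> u0; apply/funext => m; rewrite /ssum big1 // => n _; rewrite u0. Qed.

Lemma shomog_ssum r u : (forall n, shomog r (u n)) -> shomog r (ssum u).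
Proof.
move=> ur m; apply: contra_neqP => nr; rewrite /ssum big1 // => n _.
by apply/eqP; apply: contra_notT nr; apply: ur.
Qed.

Definition opsum L f : series k p q := ssum (fun n => L n f).

Lemma opsum_sge L M f : (forall n, raises n (L n)) ->
  sge M (opsum L f - \sum_(n < M) L n f).
Proof. by move=> Ln; apply: ssum_sge => n; apply: raises_sge. Qed.

Lemma raises_opsum N L : (forall n, raises N (L n)) -> raises N (opsum L).
Proof. by move=> LN M f fM; apply: ssum_sge_all => n; apply: LN. Qed.

Lemma is_der_opsum par L :
  (forall n, is_der par (L n)) -> (forall n, raises n (L n)) ->
  is_der par (opsum L).
Proof.
move=> dL rL; split.
- move=> c f g; apply/funext => m.
  rewrite addsE scalesE /opsum /ssum mulr_sumr -big_split /=.
  by apply: eq_bigr => n _; have [-> _ _ _] := dL n.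
- by move=> r f fr; apply: shomog_ssum => n; have [_ dLn _ _] := dL n; apply: dLn.
- move=> r f g fr; symmetry; apply: ssum_eq => [n|M]; first exact: raises_sge.
  under eq_bigr => n _.
    have [_ _ leib _] := dL n; rewrite (leib _ _ _ fr); over.
  rewrite big_split /= -scaler_sumr -smul_suml -smul_sumr opprD addrACA -smulBl.
  rewrite -scalerBr -smulBr.
  apply: sgeD; last apply: sgeZ.
    by have := sge_smul (opsum_sge (M := M) f rL) (sge0 g); rewrite addn0.
  exact: sge_smul (sge0 f) (opsum_sge (M := M) g rL).
move=> N; exists N => f fN; apply: ssum_sge_all => n.
by apply: sgeW (rL n _ _ fN); apply: leq_addr.
Qed.

Lemma sum_triangle (G : nat -> nat -> series k p q) M :
  \sum_(n < M) \sum_(a < n.+1) G a (n - a)%N = \sum_(a < M) \sum_(b < M - a) G a b.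
Proof.
elim: M => [|M IH]; first by rewrite !big_ord0.
rewrite big_ord_recr /= IH big_ord_recr /= subnn addrA.
rewrite [in RHS]big_ord_recr /= subSnn big_ord1 -big_split /=; congr (_ + _).
by apply: eq_bigr => a _; rewrite subSn ?(ltnW (ltn_ord a)) // big_ord_recr.
Qed.

(** Cauchy product: the terms with a + b >= M omitted from a triangle of size M
    have length at least M. *)
Lemma opsum_ssum L u :
  (forall n (c : k) f g, L n (c *: f + g) = c *: L n f + L n g) ->
  (forall n, raises n (L n)) -> (forall n, sge n (u n)) ->
  opsum L (ssum u) = ssum (fun n => \sum_(a < n.+1) L a (u (n - a)%N)).
Proof.
move=> linL rL un; apply: ssum_eq => [n|M].
  apply: sge_sum => a _; have := rL a _ _ (un (n - a)%N).
  by rewrite subnK // -ltnS.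
rewrite (sum_triangle (fun a b => L a (u b))).
rewrite -[X in X - _](subrK (\sum_(n < M) L n (ssum u))) -addrA -sumrB.
apply: sgeD; [exact: opsum_sge | apply: sge_sum => a _].
rewrite -(lin_sum (linL a)) -(linB (linL a)).
have := rL a _ _ (ssum_sge (M := (M - a)%N) un); rewrite subnK //.
exact: ltnW.
Qed.

(** Partial derivatives lower the length by one, so one more term than usual is
    needed in the partial sums. *)
Lemma divergence_opsum L : (forall n, raises n (L n)) ->
  divergence true (opsum L) = ssum (fun n => divergence true (L n)).
Proof.
move=> rL; apply: ssum_eq => [n|M].
  by apply: sge_divergence => i; apply: raises_var.
rewrite divergence_odd (_ : \sum_(n < M) divergence true (L n) =
    \sum_i \sum_(n < M) pderiv i (L n (x_ i))); last first.
  by under eq_bigr do rewrite divergence_odd; exact: exchange_big.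
rewrite -sumrB; apply: sge_sum => i _.
have linp := @pderiv_linear k p q i.
rewrite -(lin_sum linp) -(linB linp); apply: (@sge_pderiv k p q i M.+1).
have -> : opsum L (x_ i) - \sum_(n < M) L n (x_ i) =
    (opsum L (x_ i) - \sum_(n < M.+1) L n (x_ i)) + L M (x_ i).
  by rewrite big_ord_recr /= opprD addrA subrK.
by apply: sgeD; [apply: opsum_sge | apply: raises_var].
Qed.

(** The factor n + 1 = a + b is distributed over the two indices; for terms of
    exponential type both summands are then given by the recursion of the
    terms. *)
Lemma conv_succ (G : nat -> nat -> series k p q) n :
  (n.+1)%:R *: (\sum_(a < n.+2) G a (n.+1 - a)%N) =
  \sum_(a < n.+1) ((a.+1)%:R *: G a.+1 (n - a)%N + ((n - a).+1)%:R *: G a (n - a).+1).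
Proof.
rewrite big_split /= scaler_sumr.
have -> : \sum_(a < n.+2) n.+1%:R *: G a (n.+1 - a)%N =
    \sum_(a < n.+2) a%:R *: G a (n.+1 - a)%N +
    \sum_(a < n.+2) (n.+1 - a)%:R *: G a (n.+1 - a)%N.
  rewrite -big_split; apply: eq_bigr => a _ /=.
  by rewrite -scalerDl -natrD subnKC // -ltnS.
congr (_ + _).
  by rewrite big_ord_recl /= scale0r add0r; apply: eq_bigr => a _.
rewrite big_ord_recr /= subnn scale0r addr0; apply: eq_bigr => a _.
by rewrite subSn // -ltnS.
Qed.

End Summation.

Section Flow.
Variables (k : fieldType) (p q : nat).
Hypothesis char0 : forall n, n.+1%:R != 0 :> k.
Implicit Types (f g h : series k p q) (m : smono p q).
Implicit Types (D Q xi eta : series k p q -> series k p q).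
Local Notation smul := (@smul k p q).
Local Notation x_ := (@var k p q).

(** * The exponential of a gauge transformation *)

(** The term ad(xi)^n (Q) / n! of the conjugate of Q by exp(xi). *)
Fixpoint ad_exp xi Q (n : nat) : series k p q -> series k p q :=
  if n is n'.+1 then
    fun f => n%:R^-1 *: (xi (ad_exp xi Q n' f) - ad_exp xi Q n' (xi f))
  else Q.

(** The function components of the terms of the gauge action of (xi, 0). The
    divergence comes from the differential of (xi, 0), which occurs only in the
    innermost bracket; hence it is added only at the first step. *)
Fixpoint fun_exp xi f (n : nat) : series k p q :=
  if n is n'.+1 then
    n%:R^-1 *: (xi (fun_exp xi f n') +
      if n' is 0%N then 2%:R^-1 *: divergence false xi else 0)
  else f.

Lemma is_derZ par (c : k) D : is_der par D -> is_der par (fun f => c *: D f).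
Proof.
move=> dD; have [linD parD leibD _] := dD; have lc := lincontZ c (is_der_lincont dD).
split; [by case: lc | | | by case: lc].
  by move=> r f /parD; apply: shomogZ.
move=> r f g fr; rewrite (leibD _ _ _ fr) scalerDr smulZl smulZr !scalerA.
by rewrite [c * _]mulrC.
Qed.

Lemma divergenceZ par (c : k) D :
  divergence par (fun f => c *: D f) = c *: divergence par D.
Proof.
rewrite /divergence scaler_sumr; apply: eq_bigr => i _.
by rewrite (linZ (@pderiv_linear k p q i)) !scalerA mulrC.
Qed.

Section Fixed.
Variables xi Q : series k p q -> series k p q.
Hypothesis dxi : is_der false xi.
Hypothesis rxi : raises 1 xi.
Hypothesis dQ : is_der true Q.
Hypothesis rQ : raises 0 Q.

Let linxi : forall (c : k) f g, xi (c *: f + g) = c *: xi f + xi g.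
Proof. by case: dxi. Qed.

Lemma ad_expS n f :
  n.+1%:R *: ad_exp xi Q n.+1 f = xi (ad_exp xi Q n f) - ad_exp xi Q n (xi f).
Proof. by rewrite scalerA divff // scale1r. Qed.

Lemma fun_expS f n :
  n.+1%:R *: fun_exp xi f n.+1 = xi (fun_exp xi f n) +
    (if n is 0%N then 2%:R^-1 *: divergence false xi else 0).
Proof. by rewrite scalerA divff // scale1r. Qed.

Lemma ad_exp_bracket n : ad_exp xi Q n.+1 =
  fun f => n.+1%:R^-1 *: der_bracket false true xi (ad_exp xi Q n) f.
Proof. by apply/funext => f; rewrite /der_bracket scale1r. Qed.

Lemma is_der_ad_exp n : is_der true (ad_exp xi Q n).
Proof.
by elim: n => // n IH; rewrite ad_exp_bracket; apply/is_derZ/(is_der_bracket dxi IH).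
Qed.

Lemma lin_ad_exp n (c : k) f g :
  ad_exp xi Q n (c *: f + g) = c *: ad_exp xi Q n f + ad_exp xi Q n g.
Proof. by have [] := is_der_ad_exp n. Qed.

Lemma raises_ad_exp n : raises n (ad_exp xi Q n).
Proof.
elim: n => // n IH M f fM; apply: sgeZ; apply: sgeB.
  by rewrite addnS -addn1; apply/rxi/IH.
by rewrite addnS -addSn; apply: IH; rewrite -addn1; apply: rxi.
Qed.

(** Since [xi, -] is a derivation for the composition of operators, the
    convolutions E_n in the statement satisfy (n + 1) E_(n+1) = [xi, E_n], and
    E_0 is the square of Q. *)
Lemma ad_exp_square : (forall f, Q (Q f) = 0) ->
  forall n f, \sum_(a < n.+1) ad_exp xi Q a (ad_exp xi Q (n - a)%N f) = 0.
Proof.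
move=> QQ; elim=> [|n IH] f; first by rewrite big_ord1.
apply: (scalerI (char0 n)).
rewrite (conv_succ (fun a b => ad_exp xi Q a (ad_exp xi Q b f))) scaler0.
under eq_bigr => a _.
  rewrite ad_expS -(linZ (lin_ad_exp a)) ad_expS (linB (lin_ad_exp a)) addrA subrK.
  over.
by rewrite sumrB -(lin_sum linxi) !IH (lin0 linxi) subr0.
Qed.

(** The left-hand sides C_n satisfy (n + 1) C_(n+1) = xi C_n: by
    divergence_bracket, the divergence of [xi, Q_n] contributes - Q_n (div xi),
    which cancels the divergence entering fun_exp at the first step. *)
Lemma ad_exp_maurer_cartan f :
  Q f + 2%:R^-1 *: divergence true Q = 0 ->
  forall n, \sum_(a < n.+1) ad_exp xi Q a (fun_exp xi f (n - a)%N) +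
    2%:R^-1 *: divergence true (ad_exp xi Q n) = 0.
Proof.
move=> mc; elim=> [|n IH]; first by rewrite big_ord1.
apply: (scalerI (char0 n)); rewrite scaler0 scalerDr.
rewrite (conv_succ (fun a b => ad_exp xi Q a (fun_exp xi f b))).
rewrite ad_exp_bracket divergenceZ divergence_bracket //; last exact: is_der_ad_exp.
rewrite [_.+1%:R *: _]scalerA [_ * _^-1]mulrC -scalerA [_.+1%:R *: _]scalerA divff // scale1r.
have -> : \sum_(a < n.+1)
   (a.+1%:R *: ad_exp xi Q a.+1 (fun_exp xi f (n - a)%N) +
    (n - a).+1%:R *: ad_exp xi Q a (fun_exp xi f (n - a).+1)) =
  xi (\sum_(a < n.+1) ad_exp xi Q a (fun_exp xi f (n - a)%N)) +
    2%:R^-1 *: ad_exp xi Q n (divergence false xi).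
  rewrite (lin_sum linxi) big_ord_recr [in RHS]big_ord_recr /= -addrA.
  congr (_ + _).
    apply: eq_bigr => a _; rewrite -[RHS](subrK (ad_exp xi Q a (xi (fun_exp xi f (n - a)%N)))).
    rewrite ad_expS -(linZ (lin_ad_exp a)) fun_expS.
    have -> : (n - a)%N = (n - a).-1.+1 by rewrite prednK // subn_gt0.
    by rewrite addr0.
  rewrite subnn ad_expS -(linZ (lin_ad_exp n)) fun_expS /= (linD (lin_ad_exp n)).
  by rewrite (linZ (lin_ad_exp n)) addrA subrK.
rewrite scalerBr addrACA subrr addr0 -(linZ linxi) -(linD linxi) IH.
exact: lin0.
Qed.

Lemma sge_fun_exp f n : sge 1 f -> sge 1 (fun_exp xi f n).
Proof.
move=> f1; elim: n => // n IH; apply: sgeZ; apply: sgeD.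
  by apply: sgeW (rxi IH).
case: n {IH} => [|n]; last exact: sge_zero.
apply: sgeZ; apply: sge_divergence => i.
exact: raises_var.
Qed.

Lemma sge_fun_exp_index f n : sge 1 f -> sge n (fun_exp xi f n).
Proof.
move=> f1; elim: n => // n IH; case: n IH => [|n] IH; first exact: sge_fun_exp.
by apply: sgeZ; rewrite addr0 -addn1; apply: rxi.
Qed.

Lemma shomog_divergence par D : is_der par D -> shomog par (divergence par D).
Proof.
move=> dD; apply: shomog_sum => i _; apply: shomogZ.
have := shomog_pderiv (i := i) (der_var_shomog (i := i) dD).
by rewrite addbC -addbA addbb addbF.
Qed.

Lemma shomog_fun_exp f n : shomog false f -> shomog false (fun_exp xi f n).
Proof.
have [_ parxi _ _] := dxi.
move=> f0; elim: n => // n IH; apply: shomogZ; apply: shomogD; first exact: (parxi false).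
case: n {IH} => [|n]; last exact: shomog0.
by apply/shomogZ/shomog_divergence.
Qed.

End Fixed.
End Flow.

(** * The gauge orbit of a Maurer-Cartan element *)

Section Orbit.
Variables (k : fieldType) (p q : nat).
Hypothesis char0 : forall n, n.+1%:R != 0 :> k.
Local Notation smul := (@smul k p q).
Local Notation x_ := (@var k p q).
Implicit Types g h : series k p q.
Variables d m xi : series k p q -> series k p q.
Variable f : series k p q.
Hypothesis dd : is_der true d.
Hypothesis rd : raises 0 d.
Hypothesis d_square : forall g, d (d g) = 0.
Hypothesis divd : divergence true d = 0.
Hypothesis mc : maurer_cartan d (m, f).
Hypothesis dxi : is_der_ge 2 false xi.

Let Q g := d g + m g.

Let mcE : [/\ is_der_ge 2 true m, shomog false f & sge 1 f].
Proof. by case: mc. Qed.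

Let rxi : raises 1 xi.
Proof. exact: raises_der_ge dxi. Qed.

Let rm : raises 1 m.
Proof. by have [dm _ _] := mcE; apply: raises_der_ge dm. Qed.

Let linm (c : k) g h : m (c *: g + h) = c *: m g + m h.
Proof. by have [[[]]] := mcE. Qed.

Let lind (c : k) g h : d (c *: g + h) = c *: d g + d h.
Proof. by have [] := dd. Qed.

Let two_neq0 : 2%:R != 0 :> k.
Proof. exact: char0. Qed.

Let half2 g : 2%:R^-1 *: (g + g) = g.
Proof. by rewrite -mulr2n -scaler_nat scalerA mulVf ?scale1r. Qed.

Lemma is_derD par D D' : is_der par D -> is_der par D' ->
  is_der par (fun g : series k p q => D g + D' g).
Proof.
move=> dD dD'; have [_ parD leibD _] := dD; have [_ parD' leibD' _] := dD'.
have lc := lincontD (is_der_lincont dD) (is_der_lincont dD').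
split; [by case: lc | | | by case: lc].
  by move=> r g gr; apply: shomogD; [apply: parD | apply: parD'].
move=> r g h gr; rewrite (leibD _ _ _ gr) (leibD' _ _ _ gr) smulDl smulDr scalerDr.
by rewrite addrACA.
Qed.

Let dQ : is_der true Q.
Proof. by apply: is_derD => //; have [[]] := mcE. Qed.

Let rQ : raises 0 Q.
Proof.
by move=> M g gM; apply: sgeD; [apply: rd | apply: sgeW (rm gM); rewrite leq_add2l].
Qed.

Let mc1 g : d (m g) + m (d g) + m (m g) = 0.
Proof.
have [_ /(congr1 fst) E] := mc; have {E} := congr1 (fun L => L g) E.
rewrite /gdiff /gbracket /der_bracket /= => E.
rewrite -[RHS]E.
change (d (m g) + m (d g) + m (m g) =
  d (m g) - (-1) ^+ 1 *: m (d g) + 2%:R^-1 *: (m (m g) - (-1) ^+ 1 *: m (m g))).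
by rewrite expr1 !scaleN1r !opprK half2.
Qed.

Let mc2 : Q f + 2%:R^-1 *: divergence true Q = 0.
Proof.
have [_ /(congr1 snd)] := mc.
change (d f - (2%:R^-1 * (-1) ^+ 1) *: divergence true m +
   2%:R^-1 *: (m f - (-1) ^+ 1 *: m f) = 0 -> Q f + 2%:R^-1 *: divergence true Q = 0).
rewrite expr1 mulrN1 scaleNr opprK scaleN1r opprK half2 => E.
rewrite -[RHS]E /Q -addrA [RHS]addrAC -addrA; congr (_ + (_ + _)); congr (_ *: _).
rewrite -[RHS]add0r -divd !divergence_odd -big_split; apply: eq_bigr => i _ /=.
by rewrite (linD (@pderiv_linear k p q i)).
Qed.

Let Q_square g : Q (Q g) = 0.
Proof. by rewrite /Q (linD lind) (linD linm) d_square add0r addrA mc1. Qed.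

Let QS := ad_exp xi Q.
Let fS := fun_exp xi f.

(** The first component of exp(xi, 0) . (m, f) is exp(ad xi) (d + m) - d; the
    term of index 0 is corrected so that d does not occur. *)
Definition gauge_vf : series k p q -> series k p q :=
  opsum (fun n => if n is 0%N then m else ad_exp xi (fun g => d g + m g) n).

Definition gauge_fun : series k p q := ssum (fun_exp xi f).

Let raises_QS n : raises n (QS n).
Proof. exact: raises_ad_exp. Qed.

Let der_QS n : is_der true (QS n).
Proof. by apply: is_der_ad_exp => //; case: dxi. Qed.

Let raises_vf n : raises n (if n is 0%N then m else QS n).
Proof. by case: n => [|n]; [apply: raisesW rm | apply: raises_QS]. Qed.

Let f1 : sge 1 f. Proof. by case: mcE. Qed.

Lemma opsum_gauge_vf g : opsum QS g = d g + gauge_vf g.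
Proof.
apply/funext => n; rewrite addsE /gauge_vf /opsum /ssum !big_ord_recl /= addrA.
by congr (_ + _).
Qed.

Lemma is_der_gauge_vf : is_der_ge 2 true gauge_vf.
Proof.
have [[dm _] _ _] := mcE; split.
  by apply: is_der_opsum => // -[].
move=> i; apply: (raises_var (N := 1)); apply: raises_opsum => -[|n] //.
apply: (@raisesW k p q 1 n.+1 (QS n.+1)) => //; exact: raises_QS.
Qed.

Lemma gauge_gla : in_gla true (gauge_vf, gauge_fun).
Proof.
split; first exact: is_der_gauge_vf.
  by apply: shomog_ssum => n; apply: shomog_fun_exp; [case: dxi | case: mcE].
by apply: ssum_sge_all => n; apply: sge_fun_exp.
Qed.

(** The two components of the equation are sums over n of the expressions that
    vanish by ad_exp_square and ad_exp_maurer_cartan, rearranged by the Cauchy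
    product formula. *)
Lemma gauge_maurer_cartan : maurer_cartan d (gauge_vf, gauge_fun).
Proof.
split; first exact: gauge_gla.
have [[dg _] _ _] := gauge_gla.
(* The changes below evaluate the parities in the bracket and differential. *)
have ling (c : k) g h : gauge_vf (c *: g + h) = c *: gauge_vf g + gauge_vf h.
  by have [] := dg.
have linQS n (c : k) g h : QS n (c *: g + h) = c *: QS n g + QS n h.
  by have [] := der_QS n.
congr (_, _).
  apply/funext => g.
  change (d (gauge_vf g) - (-1) ^+ 1 *: gauge_vf (d g) +
    2%:R^-1 *: (gauge_vf (gauge_vf g) - (-1) ^+ 1 *: gauge_vf (gauge_vf g)) = 0).
  rewrite expr1 !scaleN1r !opprK half2.
  have <- : opsum QS (opsum QS g) = 0.
    rewrite [opsum QS g]/opsum opsum_ssum // => [|n]; last exact: raises_sge.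
    by apply: ssum0 => n; apply: ad_exp_square => //; case: dxi.
  by rewrite !opsum_gauge_vf (linD lind) (linD ling) d_square add0r addrA.
change (d gauge_fun - (2%:R^-1 * (-1) ^+ 1) *: divergence true gauge_vf +
   2%:R^-1 *: (gauge_vf gauge_fun - (-1) ^+ 1 *: gauge_vf gauge_fun) = 0).
rewrite expr1 mulrN1 scaleNr opprK scaleN1r opprK half2.
have -> : divergence true gauge_vf = divergence true (opsum QS).
  rewrite -[LHS]add0r -divd !divergence_odd -big_split; apply: eq_bigr => i _ /=.
  by rewrite opsum_gauge_vf (linD (@pderiv_linear k p q i)).
rewrite addrAC -opsum_gauge_vf divergence_opsum // /gauge_fun opsum_ssum //; last first.
  by move=> n; apply: sge_fun_exp_index.
apply/funext => n; rewrite addsE scalesE /ssum mulr_sumr -big_split big1 //= => j _.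
have := @ad_exp_maurer_cartan k p q char0 xi Q _ dQ f mc2 j.
by case: dxi => dxi' _ /(_ dxi') /(congr1 (fun u => u n)).
Qed.

Lemma gauge_termE i :
  gauge_term d (xi, 0) (m, f) i = (QS i.+1, fS i.+1).
Proof.
have [[dxi' _] [[dm _] _ _]] := (dxi, mcE).
have linQS n (c : k) g h : QS n (c *: g + h) = c *: QS n g + QS n h.
  by have [] := der_QS n.
suff E : iter i (gbracket false true (xi, 0))
    (gbracket false true (xi, 0) (m, f) - gdiff d false (xi, 0)) =
    (i.+1`!%:R *: QS i.+1, i.+1`!%:R *: fS i.+1).
  have nz : i.+1`!%:R != 0 :> k by rewrite -(prednK (fact_gt0 i.+1)) char0.
  by rewrite /gauge_term E; congr (_, _); rewrite /= scalerA mulVf ?scale1r.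
have [linxi _ _ _] := dxi'.
elim: i => [|i IH].
  rewrite (_ : 1`! = 1%N) // !scale1r /=; congr (_, _).
    apply/funext => g.
    change (xi (m g) - (-1) ^+ 0 *: m (xi g) -
      (d (xi g) - (-1) ^+ 0 *: xi (d g)) = 1%:R^-1 *: (xi (Q g) - Q (xi g))).
    rewrite expr0 !scale1r invr1 scale1r /Q (linD linxi) opprB opprD.
    by apply/funext => n; rewrite !(addsE, oppsE); ring.
  change (xi f - (-1) ^+ 0 *: m 0 - (d 0 - (2%:R^-1 * (-1) ^+ 0) *: divergence false xi)
    = 1%:R^-1 *: (xi f + 2%:R^-1 *: divergence false xi)).
  by rewrite expr0 mulr1 invr1 !scale1r (lin0 linm) (lin0 lind) subr0 sub0r opprK.
rewrite iterS IH /gbracket; congr (_, _).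
  apply/funext => g.
  change (xi (i.+1`!%:R *: QS i.+1 g) - (-1) ^+ 0 *: (i.+1`!%:R *: QS i.+1 (xi g)) =
    i.+2`!%:R *: QS i.+2 g).
  rewrite expr0 scale1r (linZ linxi) -scalerBr (factS i.+1) natrM mulrC -scalerA.
  by rewrite /QS ad_expS.
change (xi (i.+1`!%:R *: fS i.+1) - (-1) ^+ 0 *: (i.+1`!%:R *: QS i.+1 0) =
  i.+2`!%:R *: fS i.+2).
rewrite (lin0 (linQS _)) !scaler0 subr0 (linZ linxi) (factS i.+1) natrM mulrC -scalerA.
by rewrite /fS fun_expS // addr0.
Qed.

(** The partial sums of the exponential series differ from its value by
    terms of arbitrarily high length. *)
Lemma gauge_act_exp : gauge_act d (xi, 0) (m, f) (gauge_vf, gauge_fun).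
Proof.
move=> N; exists N => M le_NM; under eq_bigr do rewrite gauge_termE.
have leM : (N <= M.+1)%N by apply: leqW.
split.
  move=> i; apply: (@sgeW _ _ _ _ M.+1) => //.
  pose L (n : nat) := if n is 0%N then m else QS n.
  rewrite (_ : _ (x_ i) = - (gauge_vf (x_ i) - \sum_(n < M.+1) L n (x_ i))).
    by apply/sgeN/opsum_sge.
  rewrite opprB big_ord_recl; congr (_ + _ - _).
  by rewrite (raddf_sum fst) fct_sumE.
apply: (@sgeW _ _ _ _ M.+1) => //.
rewrite (_ : _.2 = - (gauge_fun - \sum_(n < M.+1) fS n)).
  by apply/sgeN/ssum_sge => n; apply: sge_fun_exp_index.
rewrite opprB big_ord_recl; congr (_ + _ - _).
by rewrite (raddf_sum snd).
Qed.

End Orbit.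

Section Killing.
Variables (k : fieldType) (p q : nat).
Hypothesis char0 : forall n, n.+1%:R != 0 :> k.
Implicit Types (f g h : series k p q) (m : smono p q).
Local Notation smul := (@smul k p q).
Local Notation x_ := (@var k p q).
Local Notation pderiv := (@pderiv k p q).

(** * Vector fields with prescribed divergence *)

(** The factor by which the divergence of f E multiplies the coefficient of f at
    m, where E is the sum of all t_j d/dt_j minus the sum of all s_i d/ds_i. The
    minus sign is essential: for the usual Euler field the factor is
    p - q + |a| + |S|, which can vanish at many monomials, whereas this one
    vanishes only at the product of all s_i when there are no t_j. *)
Definition weight m : nat := p + mdeg m.1 + (q - #|m.2|).

Lemma weight_eq0 m : weight m = 0%N -> [/\ p = 0%N, m.1 = 0%MM & m.2 = setT].
Proof.
move/eqP; rewrite !addn_eq0 mdeg_eq0 subn_eq0 => /andP[/andP[/eqP p0 /eqP m0] le_q].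
split=> //; apply/eqP; rewrite eqEcard subsetT cardsT card_ord.
exact: le_q.
Qed.

(** At weight zero the coefficient becomes 0, by the convention on the inverse
    of 0. *)
Definition divide_weight g : series k p q := fun m => (weight m)%:R^-1 * g m.

Definition lift_div g : series k p q -> series k p q :=
  vfield (fun i => (-1) ^+ gpar i *: smul (x_ i) (divide_weight g)).

Lemma pderiv_smul_var_diag i f m :
  pderiv i (smul (x_ i) f) m =
    (match i with inl j => (m.1 j).+1 | inr j => (j \notin m.2) : nat end)%:R * f m.
Proof.
case: m => a S; case: i => i.
  rewrite [LHS]/= smul_var_even /= mnmDE mnm1E eqxx addn1 /=; congr (_ * f (_, _)).
  by rewrite addmK.
rewrite [LHS]/= smul_var_odd /= !inE eqxx /=; case: ifPn => iS /=; first by rewrite mul0r.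
rewrite setU1K // mul1r mulrA.
rewrite (_ : #|[set t in i |: S | (t < i)%N]| = #|[set t in S | (t < i)%N]|).
  by rewrite -expr2 sqrr_sign mul1r.
by apply: eq_card => t; rewrite !inE; case: (eqVneq t i) => [->|] //=; rewrite ltnn andbF.
Qed.

Lemma divergence_lift_div g :
  divergence false (lift_div g) = fun m => if weight m == 0%N then 0 else g m.
Proof.
apply/funext => m; rewrite divergence_even /lift_div.
under eq_bigr => i _.
  rewrite vfield_var (linZ (@pderiv_linear k p q i)) scalerA -signr_addb addbb scale1r.
  over.
rewrite fct_sumE; under eq_bigr do rewrite pderiv_smul_var_diag.
rewrite -mulr_suml -natr_sum big_sumType /=.
have -> : (\sum_(i < p) (m.1 i).+1 + \sum_(i < q) (i \notin m.2) = weight m)%N.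
  rewrite /weight mdegE; congr (_ + _)%N.
    rewrite (eq_bigr (fun i => (1 + m.1 i)%N)) //.
    by rewrite big_split /= sum1_card card_ord.
  have -> : (q - #|m.2| = #|~: m.2|)%N.
    have le_q : (#|m.2| <= q)%N by rewrite -[X in (_ <= X)%N]card_ord max_card.
    by apply/eqP; rewrite -(eqn_add2l #|m.2|) cardsC card_ord subnKC.
  rewrite -sum1_card [in RHS]big_mkcond /=.
  by apply: eq_bigr => i _; rewrite inE; case: (i \in m.2).
rewrite /divide_weight; case: eqP => [-> | /eqP]; first by rewrite mul0r.
by case: (weight m) => // w _; rewrite mulrA divff // mul1r.
Qed.

Lemma sge_divide_weight N g : sge N g -> sge N (divide_weight g).
Proof. by move=> gN m lt_m; rewrite /divide_weight gN // mulr0. Qed.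

Lemma sge_lift_div N g i : sge N g ->
  sge N.+1 ((-1) ^+ gpar i *: smul (x_ i) (divide_weight g)).
Proof.
move=> gN; apply: sgeZ; rewrite -add1n.
by apply: sge_smul; [apply: sge_var | apply: sge_divide_weight].
Qed.

Lemma raises_lift_div N g : sge N g -> raises N (lift_div g).
Proof. by move=> gN; apply: raises_vfield => i; apply: sge_lift_div. Qed.

Lemma is_der_lift_div g : shomog false g -> sge 1 g -> is_der_ge 2 false (lift_div g).
Proof.
move=> g0 g1; split; last by move=> i; rewrite /lift_div vfield_var; apply: sge_lift_div.
apply: is_der_vfield => i; apply: shomogZ; rewrite -[false (+) _]addbF.
apply: shomog_smul; first exact: shomog_var.
move=> m nz; apply: g0; apply: contraNneq nz => gm.
by rewrite /divide_weight gm mulr0.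
Qed.

Lemma lift_divB g h f : lift_div (g - h) f = lift_div g f - lift_div h f.
Proof.
rewrite /lift_div /vfield -sumrB; apply: eq_bigr => i _.
rewrite -smulBl -scalerBr -smulBr; congr (smul (_ *: smul _ _) _).
by apply/funext => m; rewrite addsE oppsE /divide_weight addsE oppsE mulrBr.
Qed.

(** * Fixed points of contractions for the length filtration *)

(** The iterates of T at 0 are stationary in each length, and their limit stays
    in P by the closedness assumption. *)
Lemma sge_fixpoint (P : series k p q -> Prop) (T : series k p q -> series k p q) :
  P 0 -> (forall g, P g -> P (T g)) ->
  (forall g, (forall N, exists2 h, P h & sge N (g - h)) -> P g) ->
  (forall N g h, P g -> P h -> sge N (g - h) -> sge N.+1 (T g - T h)) ->
  exists2 g, P g & T g = g.
Proof.
move=> P0 PT Pclosed contr; pose u n := iter n T 0.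
have Pu n : P (u n) by elim: n => // n; apply: PT.
have u_step n : sge n (u n.+1 - u n).
  by elim: n => // n IH; apply: (contr _ _ _ (Pu n.+1) (Pu n) IH).
have u_cauchy n j : sge n (u (n + j)%N - u n).
  elim: j => [|j IH]; first by rewrite addn0 subrr; apply: sge_zero.
  rewrite addnS -[u _.+1](subrK (u (n + j)%N)) -addrA; apply: sgeD => //.
  by apply: sgeW (u_step _); apply: leq_addr.
(* From the iterate of index slen m + 1 on, the coefficient at m is constant. *)
pose g : series k p q := fun m => u (slen m).+1 m.
have gu n : sge n (g - u n).
  move=> m lt_m; have := u_cauchy (slen m).+1 (n - (slen m).+1)%N m (leqnn _).
  by rewrite subnKC // !addsE !oppsE /g => /eqP; rewrite subr_eq0 => /eqP ->; rewrite subrr.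
have Pg : P g by apply: Pclosed => N; exists (u N).
exists g => //; apply: eq_sge => N.
have -> : T g - g = (T g - T (u N)) - (g - u N.+1) by rewrite opprB addrA subrK.
by apply: sgeB; [apply: sgeW (contr _ _ _ Pg (Pu N) (gu N)) | apply: sgeW (gu N.+1)].
Qed.

(** * Solving the gauge equation *)

Variable f : series k p q.
Hypothesis f_even : shomog false f.
Hypothesis f_ge1 : sge 1 f.

Let S g := ssum (fun_exp (lift_div g) f).
Let half : k := 2%:R^-1.

(** To first order S g is f plus half of g, so changing g in length N changes
    S g - g / 2 only in length N + 1. *)
Lemma gauge_fun_lipschitz N g h : sge 1 g -> sge 1 h -> sge N (g - h) ->
  sge N.+1 (S g - S h -
    half *: (divergence false (lift_div g) - divergence false (lift_div h))).
Proof.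
move=> g1 h1 ghN; set r := _ - divergence _ _.
have rg := raises_lift_div g1; have rh := raises_lift_div h1.
have rN : sge N r.
  move=> m lt_m; rewrite /r addsE oppsE !divergence_lift_div.
  by case: ifP => _; [rewrite subrr | have := ghN m lt_m; rewrite addsE oppsE].
(* Only the term of index 1 depends on g to first order, through div(xi) / 2. *)
pose corr n := if n == 1%N then half *: r else 0.
pose F g n := fun_exp (lift_div g) f n.
have FD n : sge N.+1 (F g n - F h n - corr n).
  elim: n => [|n IH]; first by rewrite subrr subr0; apply: sge_zero.
  have Fgh : sge N (F g n - F h n).
    rewrite -[_ - _](subrK (corr n)); apply: sgeD; first exact: sgeW IH.
    by rewrite /corr; case: ifP => _; [apply: sgeZ | apply: sge_zero].
  have -> : F g n.+1 - F h n.+1 - corr n.+1 =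
      n.+1%:R^-1 *: (lift_div g (F g n - F h n) + lift_div (g - h) (F h n)).
    have [ling _] : lincont (lift_div g) by apply: lincont_vfield.
    rewrite (linB ling) lift_divB addrA subrK /F /= -/(F g n) -/(F h n) -scalerBr.
    rewrite opprD addrACA; case: n {IH Fgh} => [|n]; rewrite /corr /=.
      by rewrite -scalerBr invr1 !scale1r addrK.
    by rewrite !subr0 addr0.
  apply: sgeZ; apply: sgeD; first by rewrite -addn1; apply: rg.
  rewrite -add1n; apply: raises_lift_div => //.
  exact: sge_fun_exp.
have sgeS g' : sge 1 g' -> sge N.+1 (S g' - \sum_(n < N.+2) F g' n).
  move=> g'1; apply: (@sgeW _ _ _ _ N.+2) => //; apply: ssum_sge => n.
  by apply: sge_fun_exp_index => //; apply: raises_lift_div.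
have -> : S g - S h - half *: r =
    (S g - \sum_(n < N.+2) F g n) - (S h - \sum_(n < N.+2) F h n) +
    \sum_(n < N.+2) (F g n - F h n - corr n).
  rewrite !sumrB (_ : \sum_(n < N.+2) corr n = half *: r).
    by apply/funext => m; rewrite !(addsE, oppsE); ring.
  by rewrite !big_ord_recl big1 ?addr0 ?add0r.
apply: sgeD; first by apply: sgeB; apply: sgeS.
exact: sge_sum.
Qed.

(** S g vanishes away from weight zero exactly when g is a fixed point of
    g - 2 S g on these monomials, and this map is a contraction because
    subtracting 2 S g cancels the first-order dependence on g. *)
Lemma exists_gauge_fun : exists g, [/\ shomog false g, sge 1 g &
  forall m, weight m != 0%N -> S g m = 0].
Proof.
pose T g : series k p q :=
  fun m => if weight m == 0%N then 0 else g m - 2%:R * S g m.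
pose P g := shomog false g /\ sge 1 g.
suff [g [ge go] Tg] : exists2 g, P g & T g = g.
  exists g; split=> // m wm; have := congr1 (fun u => u m) Tg; rewrite /T (negPf wm).
  move=> /eqP; rewrite -subr_eq0 addrAC subrr sub0r oppr_eq0 mulf_eq0 (negPf (char0 1)).
  by move=> /eqP.
apply: sge_fixpoint => [||g Hg|N g h [_ g1] [_ h1] ghN].
- by split; [apply: shomog0 | apply: sge_zero].
- move=> g [ge go]; have [dxi _] := is_der_lift_div ge go.
  have SE : shomog false (S g) by apply: shomog_ssum => n; apply: shomog_fun_exp.
  have S1 : sge 1 (S g).
    apply: ssum_sge_all => n; apply: sge_fun_exp => //; exact: raises_lift_div.
  split=> m; rewrite /T.
    case: ifP => _; first by rewrite eqxx.
    have [g0 | /ge //] := eqVneq (g m) 0.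
    by have [S0 | /SE //] := eqVneq (S g m) 0; rewrite g0 S0 mulr0 subr0 eqxx.
  by move=> lt_m; rewrite go // S1 // mulr0 subr0 if_same.
- split.
    by apply: shomog_eq_sge => N; have [h [he _] gh] := Hg N; exists h.
  have [h [_ h1] gh] := Hg 1%N; rewrite -[g](subrK h); exact: sgeD.
- move=> m lt_m; rewrite addsE oppsE /T.
  have := gauge_fun_lipschitz g1 h1 ghN lt_m.
  rewrite !(addsE, oppsE, scalesE) !divergence_lift_div; case: ifP => _; first by rewrite subrr.
  move=> /eqP; rewrite subr_eq0 => /eqP E.
  have -> : g m - 2%:R * S g m - (h m - 2%:R * S h m) =
    g m - h m - 2%:R * (S g m - S h m) by ring.
  by rewrite E mulrA divff ?(char0 1) // mul1r subrr.
Qed.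

End Killing.

Section Differential.
Variables (k : fieldType) (V : dgVect k) (l n : nat).
Variables (e0 : l.-tuple (dg_even V)) (e1 : n.-tuple (dg_odd V)).
Hypothesis be0 : basis_of fullv e0.
Hypothesis be1 : basis_of fullv e1.
Local Notation x_ := (@var k n l).
Local Notation d := (diffW e0 e1).

(** * The differential of the symmetric algebra *)

Lemma is_der_diffW : is_der true d.
Proof.
apply: is_der_vfield => -[j|i] /=.
  by apply: shomog_sum => i _; apply: shomogZ; apply: (@shomog_var k n l (inr i)).
rewrite -scaleN1r; apply: shomogZ; apply: shomog_sum => j _; apply: shomogZ.
exact: (@shomog_var k n l (inl j)).
Qed.

Lemma raises_diffW : raises 0 d.
Proof.
apply: raises_vfield => -[j|i] /=; [|apply: sgeN]; apply: sge_sum => j' _; apply: sgeZ.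
  exact: (@sge_var k n l (inr j')).
exact: (@sge_var k n l (inl j')).
Qed.

(** The square of d is a derivation, so it vanishes once it does on generators;
    there its coefficients are those of the two composites of the differential
    of V in the bases e0 and e1. *)
Lemma diffW_square f : d (d f) = 0.
Proof.
have dd := is_der_diffW; have [lind _ _ _] := dd.
have zero_der : is_der false (fun _ : series k n l => 0).
  split=> [c g h|r g _|r g h _|N].
  - by rewrite scaler0 addr0.
  - exact: shomog0.
  - by rewrite smul0l smul0r scaler0 addr0.
  - by exists 0%N.
have dvar i : d (x_ i) = dual_diff e0 e1 i by exact: vfield_var.
have sq_var i : d (d (x_ i)) = 0.
  rewrite dvar; case: i => [j|i] /=.
    rewrite (lin_sum lind); under eq_bigr => i _.
      rewrite (linZ lind) (dvar (inr i)) /= -scaleN1r scalerA mulrN1 scaler_sumr.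
      under eq_bigr do rewrite scalerA.
      over.
    rewrite exchange_big /= big1 // => j' _; rewrite -scaler_suml.
    rewrite (_ : \sum_i _ = - coord e1 j (dg_d0 V (dg_d1 V (tnth e1 j')))).
      by rewrite dg_d01 linear0 oppr0 scale0r.
    rewrite [X in dg_d0 V X](coord_basis be0 (memvf _)) !linear_sum /= -sumrN.
    apply: eq_bigr => i _; rewrite (tnth_nth 0) !linearZ /= mulNr.
    by rewrite mulrC.
  rewrite (linN lind) (lin_sum lind); apply/eqP; rewrite oppr_eq0; apply/eqP.
  under eq_bigr => j _.
    rewrite (linZ lind) (dvar (inl j)) /= scaler_sumr.
    under eq_bigr do rewrite scalerA.
    over.
  rewrite exchange_big /= big1 // => i' _; rewrite -scaler_suml.
  rewrite (_ : \sum_j _ = coord e0 i (dg_d1 V (dg_d0 V (tnth e0 i')))).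
    by rewrite dg_d10 linear0 scale0r.
  rewrite [X in dg_d1 V X](coord_basis be1 (memvf _)) !linear_sum /=.
  apply: eq_bigr => j _; rewrite (tnth_nth 0) !linearZ /=.
  by rewrite mulrC.
have lin2 (c : k) g h : d (d (c *: g + h)) = c *: d (d g) + d (d h).
  by rewrite !lind.
have lc2 : lincont (fun g => d (d g)) by apply: lincont_comp; apply: is_der_lincont dd.
have d2 : is_der false (fun g => d (d g)).
  have [_ pard leibd _] := dd; split; [by case: lc2 | | | by case: lc2].
    by move=> r g /pard/pard; rewrite /= negbK.
  move=> r g h gr; rewrite (leibd _ _ _ gr) (linD lind) (linZ lind).
  rewrite (leibd _ _ _ (pard _ _ gr)) (leibd _ _ _ gr).
  case: r {gr} => /=; rewrite ?expr0 ?expr1 ?scale1r ?scaleN1r;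
    by apply/funext => m; rewrite !(addsE, oppsE); ring.
exact: der_ext d2 zero_der sq_var f.
Qed.

(** The divergence would be the trace of a map exchanging even and odd
    generators. *)
Lemma divergence_diffW : divergence true d = 0.
Proof.
rewrite divergence_odd big1 // => -[j|i] _; rewrite /diffW vfield_var /=.
  rewrite (lin_sum (@pderiv_linear k n l _)) big1 // => i _.
  by rewrite (linZ (@pderiv_linear k n l _)) (@pderiv_var k n l _ (inr i)) scale0r scaler0.
rewrite (linN (@pderiv_linear k n l _)) (lin_sum (@pderiv_linear k n l _)).
rewrite big1 ?oppr0 // => j _.
by rewrite (linZ (@pderiv_linear k n l _)) (@pderiv_var k n l _ (inl j)) scale0r scaler0.
Qed.

End Differential.

(** The scalar is a sign; only that it is nonzero matters, since the coefficient
    of the top monomial is arbitrary in the end. *)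
Lemma odd_top_mono (k : fieldType) (n l : nat) :
  exists2 c : k, c != 0 & odd_top k n l = c *: @mono_series k n l (0%MM, setT).
Proof.
have prodE (s : seq 'I_l) : uniq s -> exists2 c : k, c != 0 &
    \big[@smul k n l/@sone k n l]_(i <- s) var k (inr i) =
      c *: @mono_series k n l (0%MM, [set i in s]).
  elim: s => [_|i s IH /= /andP[nis /IH[c c0 E]]].
    exists 1; first exact: oner_neq0.
    by rewrite big_nil scale1r; congr (mono_series _ (_, _)); apply/setP => i; rewrite !inE.
  exists (c * (-1) ^+ inversions [set i] [set j in s]).
    by rewrite mulf_neq0 // signr_eq0.
  rewrite big_cons E smulZr smul_mono /= addm0 disjoints1 inE nis scalerA.
  by rewrite set_cons.
have [c c0 E] := prodE (index_enum 'I_l) (index_enum_uniq _).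
exists c => //; rewrite /odd_top E; congr (_ *: mono_series _ (_, _)).
by apply/setP => i; rewrite !inE mem_index_enum.
Qed.

(** * Strictification *)

(** The gauge parameter is the vector field whose divergence solves the fixed
    point equation of exists_gauge_fun. *)
Lemma gauge_to_weight0 (k : fieldType) (hchar : [pchar k] =i pred0)
    (V : dgVect k) (l n : nat)
    (e0 : l.-tuple (dg_even V)) (e1 : n.-tuple (dg_odd V))
    (he0 : basis_of fullv e0) (he1 : basis_of fullv e1)
    (m : series k n l -> series k n l) (f : series k n l) :
  unimodular_Linf e0 e1 (m, f) ->
  exists m' f', [/\ unimodular_Linf e0 e1 (m', f'),
    Linf_equiv e0 e1 (m, f) (m', f') &
    forall x, weight x != 0%N -> f' x = 0].
Proof.
move=> mc.
have char0 j : j.+1%:R != 0 :> k by have /pcharf0P -> := hchar.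
have [_ f_even f1] : in_gla true (m, f) by case: mc.
have [g [g_even g1 gf]] := exists_gauge_fun char0 f_even f1.
have dxi := is_der_lift_div g_even g1.
have dd := is_der_diffW e0 e1; have rd := @raises_diffW k V l n e0 e1.
have d2 := diffW_square he0 he1; have divd := divergence_diffW e0 e1.
exists (gauge_vf (diffW e0 e1) m (lift_div g)), (gauge_fun (lift_div g) f).
split => //; first exact: gauge_maurer_cartan.
exists (lift_div g, 0); split; last exact: gauge_act_exp.
by split=> //; apply: shomog0.
Qed.

Theorem theorem4p6 (k : fieldType) (hchar : [pchar k] =i pred0)
    (V : dgVect k) (l n : nat)
    (e0 : l.-tuple (dg_even V)) (e1 : n.-tuple (dg_odd V))
    (he0 : basis_of fullv e0) (he1 : basis_of fullv e1)
    (m : series k n l -> series k n l) (f : series k n l)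
    (hmf : unimodular_Linf e0 e1 (m, f)) :
  ((0 < n)%N \/ odd l ->
    exists m' : series k n l -> series k n l,
      strictly_unimodular_Linf e0 e1 m' /\
      Linf_equiv e0 e1 (m, f) (m', 0)) /\
  (n = 0%N /\ ~~ odd l ->
    exists (m' : series k n l -> series k n l) (c : k),
      unimodular_Linf e0 e1 (m', c *: odd_top k n l) /\
      Linf_equiv e0 e1 (m, f) (m', c *: odd_top k n l)).
Proof.
have [m' [f' [mc' eqv f'0]]] := gauge_to_weight0 hchar he0 he1 hmf.
have [_ f'_even _] : in_gla true (m', f') by case: mc'.
split=> [nl | [n0 _]].
  suff f'z : f' = 0 by rewrite f'z in mc' eqv; exists m'.
  apply/funext => x; have [/eqP/weight_eq0[n0 _ xT] | /f'0 //] := boolP (weight x == 0%N).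
  have [// | /f'_even] := eqVneq (f' x) 0.
  rewrite xT cardsT card_ord; case: nl => [n_gt0 | -> //].
  by exfalso; move: n_gt0; rewrite n0.
have [c c0 topE] := odd_top_mono k n l.
exists m', (c^-1 * f' (0%MM, setT)).
rewrite (_ : _ *: odd_top k n l = f') // topE scalerA mulrAC mulVf // mul1r.
apply/funext => x; rewrite scalesE /mono_series.
case: (x =P _) => [-> | nx]; first by rewrite mulr1.
rewrite mulr0 f'0 //; apply/eqP => /weight_eq0[_ xa xS]; apply: nx.
by rewrite -xa -xS; case: (x).
Qed.
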